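(* There is an algorithm running in time $2^{2^{\mathrm{poly}(n)}}$ ($n$ the bit length of the input; $\mathsf{2\text{-}EXPTIME}$) which decides, given any $x, y \in \mathbb{N}$ and any finite set $F$ of functions $f_i(z) = a_i z + b_i$ with $a_i, b_i \in \mathbb{Z}$, whether $x \xrightarrow{F}_+ y$.
   Context: $\mathbb{N} = \{0,1,2,\dots\}$. For a set $S$ of affine functions $\mathbb{Z}\to\mathbb{Z}$, an $S$-composition is a finite tuple $(s_1,\dots,s_K)$ with $K \ge 0$ and each $s_i \in S$, identified with the function $s_K \circ \dots \circ s_1$. Its orbit at $x$ is $\{x, s_1(x), (s_2\circ s_1)(x), \dots, (s_K\circ\dots\circ s_1)(x)\}$. The composition is valid with respect to $x$ if every element of its orbit at $x$ is nonnegative. We write $x \xrightarrow{S}_+ y$ if there is an $S$-composition $G$ valid with respect to $x$ with $G(x) = y$. *)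

(* Defs.v *)
From Stdlib Require Import ZArith List Arith.
Import ListNotations.
Open Scope Z_scope.

Definition affine := (Z * Z)%type.
Definition app_aff (f : affine) (z : Z) : Z := fst f * z + snd f.

Fixpoint orbit (x : Z) (s : list affine) : list Z :=
  x :: match s with
       | [] => []
       | f :: s' => orbit (app_aff f x) s'
       end.

Fixpoint comp_val (x : Z) (s : list affine) : Z :=
  match s with
  | [] => x
  | f :: s' => comp_val (app_aff f x) s'
  end.

Definition valid (x : Z) (s : list affine) : Prop :=
  Forall (fun z => 0 <= z) (orbit x s).

Definition reach (F : list affine) (x y : Z) : Prop :=
  exists s : list affine,
    Forall (fun f => In f F) s /\ valid x s /\ comp_val x s = y.

Inductive sym := S0 | S1 | Ssep | Sblank.
Inductive dir := DL | DR | DN.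

(* States are natural numbers; only the states < nst are used
   (see wf_TM), so the control is finite. [delta q a = None] means halt. *)
Record TM := {
  nst : nat;
  start : nat;
  acc : nat;
  delta : nat -> sym -> option (nat * sym * dir)
}.

Definition wf_TM (M : TM) : Prop :=
  (start M < nst M)%nat /\ (acc M < nst M)%nat /\
  forall q a q' b d, (q < nst M)%nat -> delta M q a = Some (q', b, d) ->
                     (q' < nst M)%nat.

(* configuration: state, reversed left part, scanned symbol, right part *)
Record config := { cst : nat; cleft : list sym; ccur : sym; cright : list sym }.

Definition move (d : dir) (l : list sym) (a : sym) (r : list sym)
  : list sym * sym * list sym :=
  match d with
  | DN => (l, a, r)
  | DL => match l with
          | [] => ([], Sblank, a :: r)
          | b :: l' => (l', b, a :: r)
          end
  | DR => match r with
          | [] => (a :: l, Sblank, [])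
          | b :: r' => (a :: l, b, r')
          end
  end.

Definition step (M : TM) (c : config) : option config :=
  match delta M (cst c) (ccur c) with
  | None => None
  | Some (q', b, d) =>
      let '(l, a, r) := move d (cleft c) b (cright c) in
      Some {| cst := q'; cleft := l; ccur := a; cright := r |}
  end.

Fixpoint iter_step (M : TM) (n : nat) (c : config) : option config :=
  match n with
  | O => Some c
  | S n' => match step M c with
            | None => None
            | Some c' => iter_step M n' c'
            end
  end.

Definition init (M : TM) (w : list sym) : config :=
  match w with
  | [] => {| cst := start M; cleft := []; ccur := Sblank; cright := [] |}
  | a :: w' => {| cst := start M; cleft := []; ccur := a; cright := w' |}
  end.

Fixpoint pos_bits (p : positive) : list sym :=
  match p with
  | xI p' => S1 :: pos_bits p'
  | xO p' => S0 :: pos_bits p'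
  | xH => [S1]
  end.

Definition N_bits (n : N) : list sym :=
  match n with N0 => [] | Npos p => pos_bits p end.

Definition enc_nat (n : nat) : list sym := N_bits (N.of_nat n).

Definition enc_int (z : Z) : list sym :=
  (if z <? 0 then S1 else S0) :: N_bits (Z.abs_N z).

Definition enc_input (x y : nat) (F : list affine) : list sym :=
  enc_nat x ++ [Ssep] ++ enc_nat y ++
  flat_map (fun f => [Ssep] ++ enc_int (fst f) ++ [Ssep] ++ enc_int (snd f)) F.

(* Main.v *)
Require Import Defs.
From Stdlib Require Import ZArith List Arith Lia Classical FunctionalExtensionality.
Import ListNotations.

(** Let [W >= 1] bound [x], [y] and all coefficients. Above [W] only maps [a z + b] with [a >= 1]
    apply, apart from constant maps, which can be applied at once instead. A path that climbs
    above [W (W + 1)] and later returns to [0, W] without a constant map enters [0, W] by a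
    decrement by some [d <= W]. Modulo [d] its walk can be shortened to at most [d] steps;
    at that height such a walk can be replayed while multiples of [d] are subtracted to keep
    the values small. Hence [y] is reachable iff it is reachable inside [0, N] with [N]
    polynomial in [W], that is, unless some subset of [0, N] that is closed under the maps
    within [0, N] contains [x] but not [y].

    Read as a base-4 number [I], the input satisfies [W <= I + 1], and the subsets are coded
    by the numbers below [2 ^ (N + 1)]. Testing one subset takes time polynomial in unary
    arguments on a register machine, so all tests take [2 ^ poly(I) = 2 ^ 2 ^ O(n)] steps. The
    registers are finally laid out as interleaved unary tracks on a Turing tape. *)

Local Open Scope Z_scope.

(** * Bounding the values on a path *)

(** The obstacle is that a path may climb arbitrarily high before it turns out to be useful, so
    reachability is not visibly a finite search. Above [W] the coefficients leave little choice: a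
    slope at most -1 makes [a z + b] negative, and a slope at least 2 gives more than [2 W - W = W].
    So from above, [[0, W]] is entered only by a constant map, which forgets its argument, or by a
    decrement by some [d], which can be repeated and therefore makes everything before it matter
    only modulo [d]. The height [W (W + 1)] is a budget: it pays for [d <= W] maps, each of which
    loses at most [W], and leaves [W] to spare. Trying all subsets is far more wasteful than
    exploring a graph, but it uses only bounded quantifiers over numbers and no record of visited
    values, and doubly exponential time allows it. The same slack allows unary registers, since the
    input number is itself only exponential in the input length. *)

Inductive path (P : Z -> Prop) (F : list affine) : Z -> Z -> Prop :=
| path_refl z : P z -> path P F z z
| path_step z f y : P z -> In f F -> path P F (app_aff f z) y -> path P F z y.

Lemma path_trans P F x y z : path P F x y -> path P F y z -> path P F x z.
Proof. induction 1; eauto using path_step. Qed.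

Lemma path_start P F x y : path P F x y -> P x.
Proof. now destruct 1. Qed.

Lemma path_end P F x y : path P F x y -> P y.
Proof. induction 1; auto. Qed.

Lemma path_snoc P F x y f : path P F x y -> In f F -> P (app_aff f y) -> path P F x (app_aff f y).
Proof.
  intros H Hf Hp. eapply path_trans; [exact H|].
  apply path_step with f; [eapply path_end; exact H | exact Hf | now apply path_refl].
Qed.

Lemma path_reach (P : Z -> Prop) F x y : (forall z, P z -> 0 <= z) -> path P F x y -> reach F x y.
Proof.
  intros HP; induction 1 as [z Hz | z f y Hz Hf _ (s & Hs & Hv & He)].
  - exists []; repeat split; auto. constructor; auto.
  - exists (f :: s); repeat split; auto. constructor; auto.
Qed.

Lemma comp_val_app x s1 s2 : comp_val x (s1 ++ s2) = comp_val (comp_val x s1) s2.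
Proof. revert x; induction s1; simpl; auto. Qed.

Lemma comp_val_congr d x y s :
  (x mod d = y mod d) -> comp_val x s mod d = comp_val y s mod d.
Proof.
  revert x y; induction s as [|f s IH]; simpl; intros x y H; auto.
  apply IH. unfold app_aff.
  assert (E : forall u, (fst f * u + snd f) mod d = (fst f * (u mod d) + snd f) mod d).
  { intros u. destruct (Z.eq_dec d 0) as [->|Hd].
    - now rewrite !Zmod_0_r.
    - rewrite <- (Zplus_mod_idemp_l (fst f * u)), <- (Zplus_mod_idemp_l (fst f * (u mod d))).
      now rewrite Zmult_mod_idemp_r. }
  rewrite (E x), (E y), H. reflexivity.
Qed.

Lemma pigeonhole (f : nat -> nat) (n : nat) :
  (forall i, (i <= n)%nat -> (f i < n)%nat) ->
  exists i j, (i < j <= n)%nat /\ f i = f j.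
Proof.
  intros Hf. apply NNPP; intros Hno.
  assert (ND : NoDup (map f (seq 0 (S n)))).
  { apply NoDup_map_NoDup_ForallPairs; [|apply seq_NoDup].
    intros i j Hi%in_seq Hj%in_seq E.
    destruct (lt_eq_lt_dec i j) as [[H|H]|H]; auto; exfalso; apply Hno.
    - exists i, j; split; [lia|auto].
    - exists j, i; split; [lia|auto]. }
  assert (IN : incl (map f (seq 0 (S n))) (seq 0 n)).
  { intros a (i & <- & Hi%in_seq)%in_map_iff. apply in_seq. specialize (Hf i). lia. }
  pose proof (NoDup_incl_length ND IN) as L.
  rewrite length_map, !length_seq in L. lia.
Qed.

(** Affine maps act on residues modulo [d], so a segment of the walk between two congruent values
    can be cut out without changing the final residue. *)
Lemma shorten_walk (Q : affine -> Prop) (d z : Z) (s : list affine) :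
  0 < d -> Forall Q s ->
  exists s', Forall Q s' /\ Z.of_nat (length s') <= d /\
             comp_val z s' mod d = comp_val z s mod d.
Proof.
  intros Hd. remember (length s) as n eqn:En. revert s En.
  induction n as [n IH] using lt_wf_ind; intros s -> Hs.
  destruct (Z_le_gt_dec (Z.of_nat (length s)) d) as [Hle|Hgt]; [now exists s|].
  (* The [d + 1] prefixes of lengths [0, ..., d] have only [d] residues available. *)
  destruct (pigeonhole (fun i => Z.to_nat (comp_val z (firstn i s) mod d)) (Z.to_nat d))
    as (i & j & Hij & E).
  { intros i _. pose proof (Z.mod_pos_bound (comp_val z (firstn i s)) d Hd). lia. }
  apply Z2Nat.inj in E; try (apply Z.mod_pos_bound; lia).
  destruct (IH (length (firstn i s ++ skipn j s))) with (s := firstn i s ++ skipn j s)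
    as (s' & H1 & H2 & H3); auto.
  - rewrite length_app, length_firstn, length_skipn. lia.
  - rewrite <- (firstn_skipn i s) in Hs. apply Forall_app in Hs as [Ha Hb].
    apply Forall_app; split; auto.
    assert (Hs : Forall Q s) by (rewrite <- (firstn_skipn i s); now apply Forall_app).
    rewrite <- (firstn_skipn j s) in Hs. now apply Forall_app in Hs as [_ Hc].
  - exists s'; repeat split; auto. rewrite H3, comp_val_app.
    rewrite (comp_val_congr _ _ (comp_val z (firstn j s))) by auto.
    now rewrite <- comp_val_app, firstn_skipn.
Qed.

(** One map sends [[0, M]] to values at most [W M + W]. Starting from [H = W (W + 1)], this
    operation is applied twice: [U = W H + W] bounds the first value above [H], and [W U + W] bounds
    the single map taken from below [U] before multiples of [d] are subtracted again. *)
Definition height (W : Z) : Z :=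
  W * (W * (W * (W + 1)) + W) + W.

Definition bounded (N z : Z) : Prop := 0 <= z <= N.

Lemma descend F N d z v :
  In (1, - d) F -> 0 < d -> 0 <= v <= z -> z <= N -> z mod d = v mod d ->
  path (bounded N) F z v.
Proof.
  intros HF Hd Hv HN E.
  assert (Hk : exists k : nat, z = v + Z.of_nat k * d).
  { exists (Z.to_nat ((z - v) / d)).
    assert (Hz : (z - v) mod d = 0) by (rewrite Zminus_mod, E, Z.sub_diag; apply Zmod_0_l).
    pose proof (Z.div_mod (z - v) d). pose proof (Z.div_pos (z - v) d). nia. }
  destruct Hk as [k ->]. clear E. induction k as [|k IH].
  - simpl. rewrite Z.add_0_r. apply path_refl. unfold bounded. lia.
  - apply path_step with (1, - d); unfold bounded; [nia|auto|].
    unfold app_aff; cbn [fst snd].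
    replace (1 * (v + Z.of_nat (S k) * d) + - d) with (v + Z.of_nat k * d) by lia.
    apply IH; nia.
Qed.

Section Bounded.

Variables (F : list affine) (W : Z).
Hypothesis HW : 1 <= W.
Hypothesis HF : forall f, In f F -> Z.abs (fst f) <= W /\ Z.abs (snd f) <= W.

Let H := W * (W + 1).
Let U := W * H + W.

Lemma app_lower f z : 1 <= fst f -> In f F -> 0 <= z -> z - W <= app_aff f z.
Proof. intros Ha Hf Hz. apply HF in Hf. unfold app_aff. nia. Qed.

Lemma app_upper f z M : In f F -> 0 <= z <= M -> app_aff f z <= W * M + W.
Proof.
  intros Hf Hz. apply HF in Hf. unfold app_aff.
  assert (fst f * z <= W * z) by nia. nia.
Qed.

(* After each map, multiples of [d] are subtracted until the value drops below [U];
   every remaining map costs at most [W], which the starting height pays for. *)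
Lemma realize_walk d s z v :
  In (1, - d) F -> 0 < d -> 0 <= v <= W ->
  Forall (fun f => In f F /\ 1 <= fst f) s ->
  Z.of_nat (length s) <= d ->
  W * (Z.of_nat (length s) + 1) <= z <= U ->
  comp_val z s mod d = v mod d ->
  path (bounded (height W)) F z v.
Proof.
  intros Hd Hd0 Hv Hs. revert z.
  assert (HdW : d <= W) by (apply HF in Hd; cbn in Hd; lia).
  assert (HU : W * (W + 1) + W <= U) by (unfold U, H; nia).
  assert (HN : height W = W * U + W) by reflexivity.
  assert (HUN : U <= height W) by nia.
  induction Hs as [|f s [Hf Ha] Hs IH]; intros z Hl Hz E; cbn [length comp_val] in *.
  - apply descend with d; auto; lia.
  - rewrite Nat2Z.inj_succ in *.
    pose proof (app_lower f z Ha Hf) as L. pose proof (app_upper f z U Hf) as R.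
    set (z' := app_aff f z) in *.
    apply path_step with f; [unfold bounded; nia | auto | fold z'].
    destruct (Z_le_gt_dec z' U) as [Hle|Hgt].
    + apply IH; try lia.
    (* The quotient is the ceiling of [(z' - U) / d], so [z''] lies in [(U - d, U]]. As [d <= W],
       this is still at least [W (W + 1)], enough for all remaining maps. *)
    + set (z'' := z' - d * ((z' - U + d - 1) / d)).
      pose proof (Z.div_mod (z' - U + d - 1) d). pose proof (Z.mod_pos_bound (z' - U + d - 1) d).
      assert (E' : z' mod d = z'' mod d).
      { unfold z''. rewrite <- (Z_mod_plus_full (z' - d * ((z' - U + d - 1) / d)) ((z' - U + d - 1) / d) d).
        f_equal. lia. }
      assert (B : U - d < z'' <= U) by (unfold z''; lia).
      assert (z'' <= z') by lia.
      assert (W * (Z.of_nat (length s) + 1) <= z'') by nia.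
      apply path_trans with z''.
      * apply descend with d; auto; nia.
      * apply IH; try lia. rewrite <- E. symmetry. now apply comp_val_congr.
Qed.

(** The walk is cut at its first value at most [W]. Each earlier map lands above [W], whereas a map
    with [a <= 0] would land at most at [b <= W]; hence all earlier slopes are positive. *)
Lemma first_descent s x :
  Forall (fun f => In f F) s -> valid x s -> W < x -> comp_val x s <= W ->
  exists s1 f s2, s = s1 ++ f :: s2 /\ In f F /\
    Forall (fun g => In g F /\ 1 <= fst g) s1 /\ W < comp_val x s1 /\
    0 <= app_aff f (comp_val x s1) <= W /\ valid (app_aff f (comp_val x s1)) s2.
Proof.
  revert x; induction s as [|f s IH]; intros x Hs Hv Hx Hy; cbn [comp_val] in *; [lia|].
  inversion Hs as [|? ? Hf Hs']; subst.
  inversion Hv as [|? ? _ Hv']; subst. fold (valid (app_aff f x) s) in Hv'.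
  assert (H0 : 0 <= app_aff f x) by (unfold valid in Hv'; destruct s; now inversion Hv').
  destruct (Z_le_gt_dec (app_aff f x) W) as [Hle|Hgt].
  - exists [], f, s. repeat split; auto.
  - destruct (IH (app_aff f x)) as (s1 & g & s2 & -> & Hg & H1 & H2 & H3 & H4); auto; [lia|].
    exists (f :: s1), g, s2. repeat split; auto; try apply H3.
    constructor; auto. split; auto.
    apply HF in Hf. unfold app_aff in Hgt. nia.
Qed.

(** Induction on the length of the walk. From at most [H] one map is copied, and it lands at most at
    [U]. From above [H] the whole excursion up to the first descent is replaced by a bounded
    path. *)
Lemma path_bounded s x :
  Forall (fun f => In f F) s -> valid x s -> x <= U -> 0 <= comp_val x s <= W ->
  path (bounded (height W)) F x (comp_val x s).
Proof.
  assert (HU : H <= U) by (unfold U, H; nia).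
  assert (HUW : W <= U) by (unfold U, H; nia).
  assert (HN : height W = W * U + W) by reflexivity.
  assert (HUN : U <= height W) by nia.
  remember (length s) as n eqn:En. revert s x En.
  induction n as [n IH] using lt_wf_ind; intros s x -> Hs Hv Hx Hy.
  assert (Hx0 : 0 <= x) by (unfold valid in Hv; destruct s; now inversion Hv).
  destruct (Z_le_gt_dec x H) as [Hle|Hgt].
  - destruct s as [|f s]; cbn [comp_val] in *.
    + apply path_refl. unfold bounded. lia.
    + inversion Hs as [|? ? Hf Hs']; subst. inversion Hv as [|? ? _ Hv']; subst.
      apply path_step with f; [unfold bounded; lia | auto |].
      apply (IH (length s)); auto. pose proof (app_upper f x H Hf). unfold U. lia.
  - assert (HxW : W < x) by (unfold H in Hgt; nia).
    destruct (first_descent s x) as (s1 & f & s2 & -> & Hf & Hs1 & Hm & Hv2 & Hval); auto; [lia|].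
    assert (Hs2 : Forall (fun f => In f F) s2).
    { apply Forall_app in Hs as [_ Hs]. now inversion Hs. }
    rewrite comp_val_app in *. cbn [comp_val] in *.
    set (m := comp_val x s1) in *.
    assert (P2 : path (bounded (height W)) F (app_aff f m) (comp_val (app_aff f m) s2)).
    { apply (IH (length s2)); auto; [rewrite length_app; cbn|]; lia. }
    apply path_trans with (app_aff f m); auto. clear P2.
    pose proof (HF f Hf) as [_ Hb].
    (* Since [m > W], slopes below 0 lead to negative values, slopes above 1 stay above [W], and
       slope 1 needs a negative constant. *)
    assert (Hc : fst f = 0 \/ fst f = 1 /\ snd f < 0) by (unfold app_aff in Hv2; nia).
    destruct Hc as [Hc|[Hc Hneg]].
    + replace (app_aff f m) with (app_aff f x) by (unfold app_aff; rewrite Hc; lia).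
      apply path_snoc; auto; [apply path_refl|]; unfold bounded; [lia|].
      unfold app_aff in *. rewrite Hc in *. lia.
    + assert (Hd : In (1, - - snd f) F) by (rewrite Z.opp_involutive, <- Hc; now destruct f).
      (* The descending map [f] has slope 1, so it may be shortened together with [s1]; the residue
         to be hit is then that of the landing point itself. *)
      destruct (shorten_walk (fun g => In g F /\ 1 <= fst g) (- snd f) x (s1 ++ [f]))
        as (s' & Hs' & Hl & E); [lia | |].
      { apply Forall_app; split; auto. constructor; auto. split; auto. lia. }
      rewrite comp_val_app in E. cbn [comp_val] in E. fold m in E.
      apply realize_walk with (d := - snd f) (s := s'); auto; try lia.
      unfold H in Hgt. nia.
Qed.

End Bounded.

Lemma reach_bounded F W x y :
  1 <= W -> (forall f, In f F -> Z.abs (fst f) <= W /\ Z.abs (snd f) <= W) ->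
  x <= W -> 0 <= y <= W -> reach F x y -> path (bounded (height W)) F x y.
Proof.
  intros HW HF Hx Hy (s & Hs & Hv & <-).
  apply path_bounded; auto. nia.
Qed.

Lemma reach_iff_bounded F W x y :
  1 <= W -> (forall f, In f F -> Z.abs (fst f) <= W /\ Z.abs (snd f) <= W) ->
  x <= W -> 0 <= y <= W -> (reach F x y <-> path (bounded (height W)) F x y).
Proof.
  intros; split; [now apply reach_bounded|].
  apply path_reach. unfold bounded. lia.
Qed.

Local Open Scope bool_scope.
Local Open Scope nat_scope.

(** * Register programs and polynomially computable functions *)

Definition upd (s : nat -> nat) (r v : nat) : nat -> nat :=
  fun x => if x =? r then v else s x.

Inductive cmd :=
| Skip
| Inc (r : nat)
| Seq (p q : cmd)
| Loop (r : nat) (p : cmd).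

(** The costs are those of the compiled code: each pass of a loop pays one step for the test with
    decrement and one for the jump back. [compile_correct] can then preserve time exactly. *)
Inductive exec : cmd -> (nat -> nat) -> nat -> (nat -> nat) -> Prop :=
| exec_skip s : exec Skip s 0 s
| exec_inc r s : exec (Inc r) s 1 (upd s r (S (s r)))
| exec_seq p q s1 t1 s2 t2 s3 :
    exec p s1 t1 s2 -> exec q s2 t2 s3 -> exec (Seq p q) s1 (t1 + t2) s3
| exec_loop_end r p s : s r = 0 -> exec (Loop r p) s 1 s
| exec_loop r p s v t1 s1 t2 s2 :
    s r = S v -> exec p (upd s r v) t1 s1 -> exec (Loop r p) s1 t2 s2 ->
    exec (Loop r p) s (S (t1 + S t2)) s2.

(** Every unit of time adds at most one to a register, so a time bound is also a bound on the
    results. *)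
Lemma exec_growth p s t s' : exec p s t s' -> forall r, s' r <= s r + t.
Proof.
  induction 1 as [| r s | p q s1 t1 s2 t2 s3 _ IH1 _ IH2 | | r p s v t1 s1 t2 s2 E _ IH1 _ IH2];
    intros x; try lia.
  - unfold upd. destruct (Nat.eqb_spec x r); subst; lia.
  - specialize (IH1 x). specialize (IH2 x). lia.
  - specialize (IH1 x). specialize (IH2 x). unfold upd in IH1.
    destruct (Nat.eqb_spec x r); subst; lia.
Qed.

Definition runs (p : cmd) (s : nat -> nat) (T : nat) (s' : nat -> nat) : Prop :=
  exists t, t <= T /\ exec p s t s'.

Lemma runs_seq p q s1 T1 s2 T2 s3 :
  runs p s1 T1 s2 -> runs q s2 T2 s3 -> runs (Seq p q) s1 (T1 + T2) s3.
Proof.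
  intros (t1 & L1 & H1) (t2 & L2 & H2). exists (t1 + t2). split; [lia|].
  eapply exec_seq; eauto.
Qed.

Lemma runs_weaken p s T T' s1 s2 : runs p s T s1 -> T <= T' -> s1 = s2 -> runs p s T' s2.
Proof. intros (t & L & H) HT <-. exists t. split; [lia|auto]. Qed.

Ltac ext_upd :=
  apply functional_extensionality; intro; unfold upd;
  repeat match goal with
         | |- context [?a =? ?b] => destruct (Nat.eqb_spec a b); subst
         end; try lia; try congruence; auto with arith.

Lemma runs_inc r s s' : s' = upd s r (S (s r)) -> runs (Inc r) s 1 s'.
Proof. intros ->. exists 1. split; [lia|constructor]. Qed.

(** [St j] is the complete store after [j] passes, so one loop proof reduces to checking one pass,
    started with the counter already decremented. The 2 pays for test and jump, the final 1 for the
    failing test. *)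
Lemma runs_loop r p n (St : nat -> nat -> nat) T :
  (forall j, j <= n -> St j r = n - j) ->
  (forall j, j < n -> runs p (upd (St j) r (n - j - 1)) T (St (S j))) ->
  runs (Loop r p) (St 0) (n * (T + 2) + 1) (St n).
Proof.
  revert St; induction n as [|n IH]; intros St Hr Hp.
  - exists 1. split; [lia|]. apply exec_loop_end. now rewrite Hr.
  - destruct (Hp 0) as (t1 & L1 & H1); [lia|].
    destruct (IH (fun j => St (S j))) as (t2 & L2 & H2).
    + intros j Hj. rewrite Hr; lia.
    + intros j Hj. 
      replace (n - j - 1) with (S n - S j - 1) by lia. apply Hp. lia.
    + exists (S (t1 + S t2)). split; [lia|].
      eapply exec_loop; eauto. rewrite Hr by lia.
      replace (S n - 0) with (S n) by lia. f_equal. lia.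
Qed.

Definition clear (r : nat) := Loop r Skip.
Definition move_reg (r r' : nat) := Loop r (Inc r').

Lemma runs_clear r s : runs (clear r) s (2 * s r + 1) (upd s r 0).
Proof.
  set (St j := upd s r (s r - j)).
  eapply runs_weaken.
  - replace s with (St 0) at 1 by (unfold St; ext_upd).
    apply runs_loop with (n := s r) (T := 0).
    + intros j _. unfold St, upd. now rewrite Nat.eqb_refl.
    + intros j Hj. exists 0. split; auto.
      replace (St (S j)) with (upd (St j) r (s r - j - 1)) by (unfold St; ext_upd).
      constructor.
  - lia.
  - unfold St. ext_upd.
Qed.

Lemma runs_move r r' s :
  r <> r' -> runs (move_reg r r') s (3 * s r + 1) (upd (upd s r' (s r' + s r)) r 0).
Proof.
  intros Hr. set (St j := upd (upd s r' (s r' + j)) r (s r - j)).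
  eapply runs_weaken.
  - replace s with (St 0) at 1 by (unfold St; ext_upd).
    apply runs_loop with (n := s r) (T := 1).
    + intros j _. unfold St, upd. now rewrite Nat.eqb_refl.
    + intros j Hj. apply runs_inc. unfold St. ext_upd.
  - lia.
  - unfold St. ext_upd.
Qed.

(** * Closure properties of functions computable in time polynomial in their unary arguments *)

Definition size (e : list nat) : nat := 2 + list_sum e.

(** Because [size e] is at least 2, its powers absorb constants and sums, so a single exponent
    describes every polynomial bound. *)
Definition poly (g : list nat -> nat) : Prop := exists c, forall e, g e <= size e ^ c.

Lemma size_pow_mono e a b : a <= b -> size e ^ a <= size e ^ b.
Proof. intros. apply Nat.pow_le_mono_r; unfold size; lia. Qed.

Lemma poly_le f g : (forall e, f e <= g e) -> poly g -> poly f.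
Proof. intros H (c & Hc). exists c. intros e. rewrite H. apply Hc. Qed.

Lemma poly_const k : poly (fun _ => k).
Proof.
  exists k. intros e.
  transitivity (2 ^ k); [apply Nat.lt_le_incl, Nat.pow_gt_lin_r; lia|].
  apply Nat.pow_le_mono_l. unfold size. lia.
Qed.

Lemma poly_size : poly size.
Proof. exists 1. intros e. rewrite Nat.pow_1_r. auto. Qed.

Lemma poly_mul f g : poly f -> poly g -> poly (fun e => f e * g e).
Proof.
  intros (a & Ha) (b & Hb). exists (a + b). intros e.
  rewrite Nat.pow_add_r. now apply Nat.mul_le_mono.
Qed.

Lemma poly_add f g : poly f -> poly g -> poly (fun e => f e + g e).
Proof.
  intros (a & Ha) (b & Hb). exists (S (a + b)). intros e.
  specialize (Ha e). specialize (Hb e).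
  pose proof (size_pow_mono e a (a + b)). pose proof (size_pow_mono e b (a + b)).
  rewrite Nat.pow_succ_r'. assert (2 <= size e) by (unfold size; lia). nia.
Qed.

Lemma poly_pow f k : poly f -> poly (fun e => f e ^ k).
Proof.
  intros H. induction k; simpl; [apply poly_const|now apply poly_mul].
Qed.

Lemma poly_sum : poly list_sum.
Proof. apply poly_le with size; [|apply poly_size]. unfold size. lia. Qed.

Lemma poly_list_sum gs : Forall poly gs -> poly (fun e => list_sum (map (fun g => g e) gs)).
Proof.
  induction 1; simpl; [apply poly_const|now apply poly_add].
Qed.

#[local] Hint Resolve poly_const poly_size poly_mul poly_add poly_pow poly_sum poly_list_sum : poly.

(* Register convention: the inputs [rho] lie below [d], the result goes to [d], and the
   scratch registers above [d] are zero before and after. *)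
Definition computes (code : list nat -> nat -> cmd) (f B : list nat -> nat) : Prop :=
  forall rho d s,
    Forall (fun r => r < d) rho -> (forall r, d <= r -> s r = 0) ->
    runs (code rho d) s (B (map s rho)) (upd s d (f (map s rho))).

Definition PF (f : list nat -> nat) : Prop :=
  exists code c, computes code f (fun e => size e ^ c).

Lemma PF_intro code f B : poly B -> computes code f B -> PF f.
Proof.
  intros (c & Hc) H. exists code, c. intros rho d s Hr Hs.
  eapply runs_weaken; eauto.
Qed.

Lemma PF_ext f g : (forall e, f e = g e) -> PF g -> PF f.
Proof. intros H. now rewrite (functional_extensionality _ _ H). Qed.

(** The result register starts at 0 and cannot exceed the running time. The store used here simply
    holds the list [e] in its first registers. *)
Lemma PF_poly f : PF f -> poly f.
Proof.
  intros (code & c & H). exists c. intros e.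
  set (s := fun r => nth r e 0).
  assert (E : map s (seq 0 (length e)) = e).
  { apply nth_ext with (d := 0) (d' := 0); rewrite length_map, length_seq; auto.
    intros n Hn. rewrite nth_indep with (d' := s 0) by (now rewrite length_map, length_seq).
    rewrite map_nth, seq_nth by auto. auto. }
  destruct (H (seq 0 (length e)) (length e) s) as (t & Ht & Hx).
  - apply Forall_forall. intros r Hr%in_seq. lia.
  - intros r Hr. now apply nth_overflow.
  - rewrite E in *. apply exec_growth with (r := length e) in Hx.
    unfold upd in Hx. rewrite Nat.eqb_refl in Hx.
    unfold s in Hx. rewrite nth_overflow in Hx by auto. lia.
Qed.

Lemma PF_const k : PF (fun _ => k).
Proof.
  induction k as [|k (code & c & IH)].
  - apply PF_intro with (code := fun _ _ => Skip) (B := fun _ => 0); auto with poly.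
    intros rho d s _ Hs. exists 0. split; auto.
    replace (upd s d 0) with s by (rewrite <- (Hs d); auto; ext_upd). constructor.
  - apply PF_intro with (code := fun rho d => Seq (code rho d) (Inc d))
                        (B := fun e => size e ^ c + 1); auto with poly.
    intros rho d s Hr Hs. eapply runs_seq; [now apply IH|].
    apply runs_inc. ext_upd.
Qed.

Lemma PF_succ g : PF g -> PF (fun e => S (g e)).
Proof.
  intros (code & c & H).
  apply PF_intro with (code := fun rho d => Seq (code rho d) (Inc d))
                      (B := fun e => size e ^ c + 1); auto with poly.
  intros rho d s Hr Hs. eapply runs_seq; [now apply H|].
  apply runs_inc. ext_upd.
Qed.

Lemma list_sum_nth_le e i : nth i e 0 <= list_sum e.
Proof. revert i; induction e as [|a e IH]; destruct i; simpl; try lia. specialize (IH i). lia. Qed.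

Lemma PF_var i : PF (fun e => nth i e 0).
Proof.
  apply PF_intro with
    (* A loop destroys its counter, so the argument is emptied into both [d] and [S d] and then
       restored from [S d]. A missing argument reads as 0, the default of [nth]. *)
    (code := fun rho d => if i <? length rho
       then Seq (Loop (nth i rho 0) (Seq (Inc d) (Inc (S d)))) (move_reg (S d) (nth i rho 0))
       else Skip)
    (B := fun e => (list_sum e * 4 + 1) + (3 * list_sum e + 1)); auto 10 with poly.
  intros rho d s Hr Hs. destruct (Nat.ltb_spec i (length rho)) as [Hi|Hi].
  - pose proof (list_sum_nth_le (map s rho) i) as Hle.
    assert (E : nth i (map s rho) 0 = s (nth i rho 0)).
    { rewrite nth_indep with (d' := s 0) by (now rewrite length_map). apply map_nth. }
    rewrite E in *.
    set (r := nth i rho 0) in *.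
    assert (Hrd : r < d) by (rewrite Forall_forall in Hr; apply Hr, nth_In, Hi).
    set (St j := upd (upd (upd s r (s r - j)) d j) (S d) j).
    eapply runs_weaken.
    + eapply runs_seq.
      * replace s with (St 0) at 1
          by (unfold St; pose proof (Hs d); pose proof (Hs (S d)); ext_upd; rewrite Hs; lia).
        apply runs_loop with (n := s r) (T := 2).
        -- intros j _. unfold St, upd. destruct (Nat.eqb_spec r (S d)), (Nat.eqb_spec r d); try lia.
           now rewrite Nat.eqb_refl.
        -- intros j Hj. change 2 with (1 + 1). eapply runs_seq; apply runs_inc; [reflexivity|].
           unfold St. ext_upd.
      * apply runs_move. lia.
    + replace (St (s r) (S d)) with (s r) by (unfold St, upd; now rewrite Nat.eqb_refl). nia.
    + unfold St. pose proof (Hs (S d)). ext_upd.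
  - rewrite nth_overflow by (now rewrite length_map).
    exists 0. split; [lia|].
    replace (upd s d 0) with s by (rewrite <- (Hs d); auto; ext_upd). constructor.
Qed.

(** Weakening: iteration puts its accumulator and index at the head of the environment, so functions
    of the outer environment are read through [tl]. *)
Lemma PF_tl g : PF g -> PF (fun e => g (tl e)).
Proof.
  intros (code & c & H).
  apply PF_intro with (code := fun rho d => code (tl rho) d) (B := fun e => size e ^ c); auto with poly.
  intros rho d s Hr Hs.
  replace (tl (map s rho)) with (map s (tl rho)) by (now destruct rho).
  eapply runs_weaken; [apply H; auto | | auto].
  - destruct rho; simpl; auto. now inversion Hr.
  - apply Nat.pow_le_mono_l. destruct rho; simpl; unfold size; simpl; lia.
Qed.

Fixpoint upds (s : nat -> nat) (d : nat) (vs : list nat) : nat -> nat :=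
  match vs with
  | [] => s
  | v :: vs => upds (upd s d v) (S d) vs
  end.

Lemma upds_spec vs d s r :
  upds s d vs r = if (d <=? r) && (r <? d + length vs) then nth (r - d) vs 0 else s r.
Proof.
  revert d s; induction vs as [|v vs IH]; intros d s; cbn [upds length].
  - destruct (Nat.leb_spec d r), (Nat.ltb_spec r (d + 0)); auto; lia.
  - rewrite IH. unfold upd.
    destruct (Nat.eqb_spec r d) as [->|Hd].
    + destruct (Nat.leb_spec (S d) d), (Nat.leb_spec d d); try lia. cbn [andb].
      destruct (Nat.ltb_spec d (d + S (length vs))); try lia.
      now rewrite Nat.sub_diag.
    + destruct (Nat.leb_spec (S d) r), (Nat.leb_spec d r); cbn [andb]; try lia; auto.
      replace (d + S (length vs)) with (S d + length vs) by lia.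
      destruct (Nat.ltb_spec r (S d + length vs)); auto.
      now replace (r - d) with (S (r - S d)) by lia.
Qed.

Lemma PF_list gs :
  Forall PF gs ->
  exists code c, forall rho d s,
    Forall (fun r => r < d) rho -> (forall r, d <= r -> s r = 0) ->
    runs (code rho d) s (size (map s rho) ^ c) (upds s d (map (fun g => g (map s rho)) gs)).
Proof.
  induction 1 as [|g gs (cg & c & Hg) _ (cgs & c' & IH)].
  - exists (fun _ _ => Skip), 0. intros. exists 0. split; [lia|constructor].
  - destruct (poly_add (fun e => size e ^ c) (fun e => size e ^ c')) as (k & Hk); auto with poly.
    exists (fun rho d => Seq (cg rho d) (cgs rho (S d))), k. intros rho d s Hr Hs.
    eapply runs_weaken; [eapply runs_seq; [now apply Hg|] | apply Hk | reflexivity].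
    assert (E : map (upd s d (g (map s rho))) rho = map s rho).
    { apply map_ext_in. intros r Hin. rewrite Forall_forall in Hr. apply Hr in Hin.
      unfold upd. destruct (Nat.eqb_spec r d); auto; lia. }
    specialize (IH rho (S d) (upd s d (g (map s rho)))). rewrite E in IH.
    apply IH.
    + eapply Forall_impl; [|exact Hr]. simpl. lia.
    + intros r Hrd. unfold upd. destruct (Nat.eqb_spec r d); [lia|]. apply Hs. lia.
Qed.

Fixpoint clears (a m : nat) : cmd :=
  match m with
  | 0 => Skip
  | S m => Seq (clear a) (clears (S a) m)
  end.

Lemma runs_clears a vs s :
  runs (clears a (length vs)) (upds s a vs) (2 * list_sum vs + length vs)
       (fun r => if (a <=? r) && (r <? a + length vs) then 0 else s r).
Proof.
  revert a s; induction vs as [|v vs IH]; intros a s; cbn [length clears upds].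
  - eapply runs_weaken; [exists 0; split; [apply le_n | constructor] | simpl; lia |].
    apply functional_extensionality. intros r.
    destruct (Nat.leb_spec a r), (Nat.ltb_spec r (a + 0)); auto; lia.
  - eapply runs_weaken.
    + eapply runs_seq; [apply runs_clear|].
      replace (upd (upds (upd s a v) (S a) vs) a 0) with (upds (upd s a 0) (S a) vs); [apply IH|].
      apply functional_extensionality. intros r. unfold upd at 2. rewrite !upds_spec.
      unfold upd. destruct (Nat.eqb_spec r a) as [->|]; auto.
      destruct (Nat.leb_spec (S a) a); auto. lia.
    + rewrite upds_spec. destruct (Nat.leb_spec (S a) a); [lia|]. cbn [andb].
      unfold upd. rewrite Nat.eqb_refl. simpl. lia.
    + apply functional_extensionality. intros r. unfold upd.
      destruct (Nat.leb_spec (S a) r), (Nat.ltb_spec r (S a + length vs)),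
        (Nat.leb_spec a r), (Nat.ltb_spec r (a + S (length vs))), (Nat.eqb_spec r a);
        cbn [andb]; auto; lia.
Qed.

Lemma map_upds_seq s d vs : map (upds s d vs) (seq d (length vs)) = vs.
Proof.
  apply nth_ext with (d := 0) (d' := 0); rewrite length_map, length_seq; auto.
  intros n Hn. rewrite nth_indep with (d' := upds s d vs 0) by (now rewrite length_map, length_seq).
  rewrite map_nth, seq_nth, upds_spec by auto.
  destruct (Nat.leb_spec d (d + n)), (Nat.ltb_spec (d + n) (d + length vs)); try lia.
  cbn [andb]. f_equal. lia.
Qed.

(** Register [d] is kept free while the arguments occupy the next [m] registers and the result of
    [f] the one above them. The cost of [f] is polynomial in the argument values, which [PF_poly]
    bounds polynomially in [e]. *)
Lemma PF_comp f gs : PF f -> Forall PF gs -> PF (fun e => f (map (fun g => g e) gs)).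
Proof.
  intros Hf Hgs. pose proof (PF_poly f Hf) as Pf.
  destruct Hf as (cf & a & Hf), (PF_list gs Hgs) as (cg & b & Hg).
  assert (PS : poly (fun e => list_sum (map (fun g => g e) gs))).
  { apply poly_list_sum. eapply Forall_impl; [|exact Hgs]. exact PF_poly. }
  set (m := length gs). destruct Pf as (k & Hk).
  apply PF_intro with
    (code := fun rho d => Seq (cg rho (S d)) (Seq (cf (seq (S d) m) (S d + m))
               (Seq (clears (S d) m) (move_reg (S d + m) d))))
    (B := fun e => let v := list_sum (map (fun g => g e) gs) in
       size e ^ b + ((2 + v) ^ a + ((2 * v + m) + (3 * (2 + v) ^ k + 1)))).
  { cbn zeta. auto 20 with poly. }
  intros rho d s Hr Hs. cbn zeta.
  set (vs := map (fun g => g (map s rho)) gs).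
  assert (Hm : length vs = m) by apply length_map.
  assert (Hf' : runs (cf (seq (S d) m) (S d + m)) (upds s (S d) vs) ((2 + list_sum vs) ^ a)
                  (upd (upds s (S d) vs) (S d + m) (f vs))).
  { rewrite <- Hm. eapply runs_weaken; [apply Hf| |].
    - apply Forall_forall. intros r Hin%in_seq. lia.
    - intros r Hge. rewrite upds_spec. destruct (Nat.ltb_spec r (S d + length vs)); [lia|].
      rewrite Bool.andb_false_r. apply Hs. lia.
    - rewrite map_upds_seq. reflexivity.
    - now rewrite map_upds_seq. }
  eapply runs_weaken.
  - eapply runs_seq; [apply Hg; [eapply Forall_impl; [|exact Hr]; simpl; lia | intros; apply Hs; lia]|].
    eapply runs_seq; [exact Hf'|].
    replace (upd (upds s (S d) vs) (S d + m) (f vs)) with (upds (upd s (S d + m) (f vs)) (S d) vs).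
    + eapply runs_seq; [rewrite <- Hm at 1; apply runs_clears|]. apply runs_move. lia.
    + apply functional_extensionality. intros r. unfold upd. rewrite !upds_spec.
      destruct (Nat.eqb_spec r (S d + m)); auto. destruct (Nat.ltb_spec r (S d + length vs)); [lia|].
      now rewrite Bool.andb_false_r.
  - fold vs. cbn beta.
    assert (E : (if (S d <=? S d + m) && (S d + m <? S d + length vs) then 0
                 else upd s (S d + m) (f vs) (S d + m)) = f vs).
    { unfold upd. rewrite Nat.eqb_refl. destruct (Nat.ltb_spec (S d + m) (S d + length vs)); [lia|].
      now rewrite Bool.andb_false_r. }
    rewrite E, Hm. specialize (Hk vs). unfold size in *. lia.
  - cbn beta. fold vs. apply functional_extensionality. intros r. unfold upd. rewrite Hm.
    pose proof (Hs d). pose proof (Hs (S d + m)).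
    destruct (Nat.eqb_spec r (S d + m)) as [->|].
    + destruct (Nat.eqb_spec (S d + m) d); [lia|]. symmetry. apply Hs. lia.
    + destruct (Nat.eqb_spec r d) as [->|].
      * destruct (Nat.leb_spec (S d) d); [lia|]. cbn [andb].
        rewrite Nat.eqb_refl. destruct (Nat.eqb_spec d (S d + m)); [lia|].
        rewrite Hs by lia. destruct (Nat.ltb_spec (S d + m) (S d + m)); [lia|].
        now rewrite Bool.andb_false_r.
      * destruct (Nat.leb_spec (S d) r); cbn [andb]; auto.
        destruct (Nat.ltb_spec r (S d + m)); auto. symmetry. apply Hs. lia.
Qed.

Fixpoint iter_fun (init step : list nat -> nat) (e : list nat) (j : nat) : nat :=
  match j with
  | 0 => init e
  | S j => step (iter_fun init step e j :: j :: e)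
  end.

(** Primitive recursion limited by [g]: iterated doubling shows that a polynomial step alone would
    not keep the intermediate values polynomial. Registers [d], [S d] and [S (S d)] hold the
    countdown, the accumulator and the index; [3 + d] receives the next accumulator. *)
Lemma PF_iter n init step g :
  PF n -> PF init -> PF step -> poly g ->
  (forall e j, j <= n e -> iter_fun init step e j <= g e) ->
  PF (fun e => iter_fun init step e (n e)).
Proof.
  intros Hn Hi Hst Pg Hb. pose proof (PF_poly n Hn) as Pn.
  destruct Hn as (cn & a & Hn), Hi as (ci & b & Hi), Hst as (cs & c & Hst).
  apply PF_intro with
    (code := fun rho d =>
       Seq (cn rho d) (Seq (ci rho (S d)) (Seq
         (Loop d (Seq (cs (S d :: S (S d) :: rho) (3 + d))
                 (Seq (clear (S d)) (Seq (move_reg (3 + d) (S d)) (Inc (S (S d)))))))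
         (Seq (clear (S (S d))) (move_reg (S d) d)))))
    (B := fun e => size e ^ a + (size e ^ b +
            ((n e * (((g e + n e + size e) ^ c + (2 * g e + 1 + (3 * g e + 1 + 1))) + 2) + 1)
              + ((2 * n e + 1) + (3 * g e + 1))))).
  { auto 30 with poly. }
  intros rho d s Hr Hs.
  assert (Emap : forall s', (forall r, r < d -> s' r = s r) -> map s' rho = map s rho).
  { intros s' H. apply map_ext_in. intros r Hin. apply H. rewrite Forall_forall in Hr. auto. }
  set (e := map s rho) in *. set (R := iter_fun init step e).
  set (St j := upd (upd (upd s d (n e - j)) (S d) (R j)) (S (S d)) j).
  assert (HR : forall j, j <= n e -> R j <= g e) by (intros; now apply Hb).
  eapply runs_weaken.
  - eapply runs_seq; [now apply Hn|]. fold e.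
    eapply runs_seq; [apply Hi|].
    { eapply Forall_impl; [|exact Hr]. simpl. lia. }
    { intros r H. unfold upd. destruct (Nat.eqb_spec r d); [lia|]. apply Hs. lia. }
    rewrite (Emap (upd s d (n e)))
      by (intros r H; unfold upd; destruct (Nat.eqb_spec r d); auto; lia).
    replace (upd (upd s d (n e)) (S d) (init e)) with (St 0)
      by (unfold St, R; cbn [iter_fun]; pose proof (Hs (S (S d))); ext_upd; symmetry; apply Hs; lia).
    eapply runs_seq; [apply runs_loop with (n := n e)
      (T := (g e + n e + size e) ^ c + (2 * g e + 1 + (3 * g e + 1 + 1)))|].
    { intros j _. unfold St, upd. rewrite Nat.eqb_refl.
      destruct (Nat.eqb_spec d (S (S d))), (Nat.eqb_spec d (S d)); auto; lia. }
    { intros j Hj.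
      set (s1 := upd (St j) d (n e - j - 1)).
      assert (E1 : map s1 (S d :: S (S d) :: rho) = R j :: j :: e).
      { cbn [map]. rewrite (Emap s1).
        - unfold s1, St, upd. rewrite !Nat.eqb_refl.
          destruct (Nat.eqb_spec (S d) d), (Nat.eqb_spec (S d) (S (S d))),
            (Nat.eqb_spec (S (S d)) d); auto; lia.
        - intros r H. unfold s1, St, upd.
          destruct (Nat.eqb_spec r d), (Nat.eqb_spec r (S d)), (Nat.eqb_spec r (S (S d))); auto; lia. }
      assert (Hs1 : runs (cs (S d :: S (S d) :: rho) (3 + d)) s1 ((g e + n e + size e) ^ c)
                      (upd s1 (3 + d) (R (S j)))).
      { eapply runs_weaken; [apply Hst| |].
        - repeat constructor; try lia. eapply Forall_impl; [|exact Hr]. simpl. lia.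
        - intros r H. unfold s1, St, upd.
          destruct (Nat.eqb_spec r d), (Nat.eqb_spec r (S d)), (Nat.eqb_spec r (S (S d))); try lia.
          apply Hs. lia.
        - rewrite E1. apply Nat.pow_le_mono_l. specialize (HR j). unfold size. simpl. lia.
        - now rewrite E1. }
      eapply runs_seq; [exact Hs1|].
      eapply runs_seq.
      { eapply runs_weaken; [apply runs_clear| |reflexivity].
        transitivity (2 * R j + 1); [|specialize (HR j); lia].
        apply Nat.eq_le_incl. do 2 f_equal. unfold s1, St, upd.
        rewrite !Nat.eqb_refl.
        destruct (Nat.eqb_spec (S d) (3 + d)), (Nat.eqb_spec (S d) d),
          (Nat.eqb_spec (S d) (S (S d))); auto; lia. }
      eapply runs_seq.
      { eapply runs_weaken; [apply runs_move; lia| |reflexivity].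
        transitivity (3 * R (S j) + 1); [|specialize (HR (S j)); lia].
        apply Nat.eq_le_incl. do 2 f_equal. unfold upd.
        rewrite !Nat.eqb_refl.
        destruct (Nat.eqb_spec (3 + d) (S d)); auto; lia. }
      apply runs_inc. unfold s1, St.
      pose proof (Hs (3 + d)). ext_upd. }
    eapply runs_seq; [apply runs_clear|]. apply runs_move. lia.
  - specialize (HR (n e)).
    replace (St (n e) (S (S d))) with (n e) by (unfold St, upd; now rewrite Nat.eqb_refl).
    replace (upd (St (n e)) (S (S d)) 0 (S d)) with (R (n e)).
    2:{ unfold St, upd. rewrite Nat.eqb_refl. destruct (Nat.eqb_spec (S d) (S (S d))); auto; lia. }
    rewrite (Emap (upd s d (n e)))
      by (intros r H; unfold upd; destruct (Nat.eqb_spec r d); auto; lia).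
    fold e. lia.
  - unfold St. fold e. fold R. pose proof (Hs (S d)). pose proof (Hs (S (S d))). ext_upd.
    all: try (symmetry; apply Hs; lia).
Qed.

#[local] Hint Resolve PF_const PF_var PF_succ PF_tl PF_poly : PF.

Lemma PF_tl2 g : PF g -> PF (fun e => g (tl (tl e))).
Proof. intros. apply (PF_tl (fun e => g (tl e))). auto with PF. Qed.
#[local] Hint Resolve PF_tl2 : PF.

(** An iteration that returns its index ends with the last index, one less than the number of
    passes. *)
Lemma PF_pred g : PF g -> PF (fun e => pred (g e)).
Proof.
  intros H. apply PF_ext with (g := fun e => iter_fun (fun _ => 0) (fun e => nth 1 e 0) e (g e)).
  - intros e. now destruct (g e).
  - apply PF_iter with (g := g); auto with PF.
    intros e j Hj. destruct j; simpl; lia.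
Qed.

Lemma PF_add g h : PF g -> PF h -> PF (fun e => g e + h e).
Proof.
  intros Hg Hh.
  assert (E : forall e j, iter_fun g (fun e => S (nth 0 e 0)) e j = g e + j)
    by (induction j; simpl in *; lia).
  apply PF_ext with (g := fun e => iter_fun g (fun e => S (nth 0 e 0)) e (h e)); auto.
  apply PF_iter with (g := fun e => g e + h e); auto with PF poly.
  intros e j Hj. rewrite E. lia.
Qed.
#[local] Hint Resolve PF_pred PF_add : PF.

Lemma PF_sub g h : PF g -> PF h -> PF (fun e => g e - h e).
Proof.
  intros Hg Hh.
  assert (E : forall e j, iter_fun g (fun e => pred (nth 0 e 0)) e j = g e - j)
    by (induction j; simpl in *; lia).
  apply PF_ext with (g := fun e => iter_fun g (fun e => pred (nth 0 e 0)) e (h e)); auto.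
  apply PF_iter with (g := g); auto with PF.
  intros e j Hj. rewrite E. lia.
Qed.

Lemma PF_mul g h : PF g -> PF h -> PF (fun e => g e * h e).
Proof.
  intros Hg Hh.
  assert (E : forall e j, iter_fun (fun _ => 0) (fun e => nth 0 e 0 + g (tl (tl e))) e j = g e * j)
    by (induction j; simpl in *; lia).
  apply PF_ext with (g := fun e => iter_fun (fun _ => 0) (fun e => nth 0 e 0 + g (tl (tl e))) e (h e)); auto.
  apply PF_iter with (g := fun e => g e * h e); auto with PF poly.
  intros e j Hj. rewrite E. nia.
Qed.
#[local] Hint Resolve PF_sub PF_mul : PF.

Definition PFb (p : list nat -> bool) : Prop := PF (fun e => Nat.b2n (p e)).

Lemma PFb_negb p : PFb p -> PFb (fun e => negb (p e)).
Proof.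
  intros H. apply PF_ext with (g := fun e => 1 - Nat.b2n (p e)); [|auto with PF].
  intros e. now destruct (p e).
Qed.

Lemma PFb_andb p q : PFb p -> PFb q -> PFb (fun e => p e && q e).
Proof.
  intros H H'. apply PF_ext with (g := fun e => Nat.b2n (p e) * Nat.b2n (q e)); [|auto with PF].
  intros e. now destruct (p e), (q e).
Qed.
#[local] Hint Resolve PFb_negb PFb_andb : PF.

Lemma PFb_orb p q : PFb p -> PFb q -> PFb (fun e => p e || q e).
Proof.
  intros H H'. apply PF_ext with (g := fun e => Nat.b2n (negb (negb (p e) && negb (q e)))).
  - intros e. now destruct (p e), (q e).
  - apply PFb_negb, PFb_andb; auto with PF.
Qed.

Lemma PFb_leb g h : PF g -> PF h -> PFb (fun e => g e <=? h e).
Proof.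
  intros H H'. apply PF_ext with (g := fun e => 1 - (g e - h e)); [|auto with PF].
  intros e. destruct (Nat.leb_spec (g e) (h e)); cbn [Nat.b2n]; lia.
Qed.
#[local] Hint Resolve PFb_orb PFb_leb : PF.

Lemma PFb_eqb g h : PF g -> PF h -> PFb (fun e => g e =? h e).
Proof.
  intros H H'. apply PF_ext with (g := fun e => Nat.b2n ((g e <=? h e) && (h e <=? g e))).
  - intros e. f_equal. destruct (Nat.eqb_spec (g e) (h e)), (Nat.leb_spec (g e) (h e)),
      (Nat.leb_spec (h e) (g e)); simpl; auto; lia.
  - apply PFb_andb; auto with PF.
Qed.

(** The truth value is the number of passes: none leaves [h e], one overwrites it with [g e]. *)
Lemma PF_if p g h : PFb p -> PF g -> PF h -> PF (fun e => if p e then g e else h e).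
Proof.
  intros Hp Hg Hh.
  apply PF_ext with (g := fun e => iter_fun h (fun e => g (tl (tl e))) e (Nat.b2n (p e))).
  - intros e. now destruct (p e).
  - apply PF_iter with (g := fun e => g e + h e); auto with PF poly.
    intros e [|j] _; simpl; lia.
Qed.
#[local] Hint Resolve PFb_eqb PF_if : PF.

Lemma PFb_forallb p n :
  PFb p -> PF n -> PFb (fun e => forallb (fun j => p (j :: e)) (seq 0 (n e))).
Proof.
  intros Hp Hn.
  assert (E : forall e j, iter_fun (fun _ => 1) (fun e => nth 0 e 0 * Nat.b2n (p (tl e))) e j
                          = Nat.b2n (forallb (fun j => p (j :: e)) (seq 0 j))).
  { induction j as [|j IH]; auto. rewrite seq_S, forallb_app. cbn [iter_fun forallb nth tl plus].
    rewrite IH, Bool.andb_true_r. now destruct forallb, p. }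
  apply PF_ext with
    (g := fun e => iter_fun (fun _ => 1) (fun e => nth 0 e 0 * Nat.b2n (p (tl e))) e (n e)); auto.
  apply PF_iter with (g := fun _ => 1); auto with PF poly.
  - apply PF_mul; auto with PF. apply PF_tl with (g := fun e => Nat.b2n (p e)). exact Hp.
  - intros e j _. rewrite E. destruct forallb; simpl; lia.
Qed.

(** Counting up to [g e], the quotient increases exactly when the counter reaches the next multiple
    of [k]. *)
Lemma PF_div g k : k <> 0 -> PF g -> PF (fun e => g e / k).
Proof.
  intros Hk Hg.
  set (step := fun e => if S (nth 0 e 0) * k <=? S (nth 1 e 0) then S (nth 0 e 0) else nth 0 e 0).
  assert (E : forall e j, iter_fun (fun _ => 0) step e j = j / k).
  { induction j as [|j IH]; [now rewrite Nat.Div0.div_0_l|].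
    cbn [iter_fun]. rewrite IH. unfold step. cbn [nth].
    pose proof (Nat.div_mod j k Hk). pose proof (Nat.mod_upper_bound j k Hk).
    destruct (Nat.leb_spec (S (j / k) * k) (S j)).
    - apply Nat.div_unique with (r := S j - S (j / k) * k); nia.
    - apply Nat.div_unique with (r := S j - j / k * k); nia. }
  apply PF_ext with (g := fun e => iter_fun (fun _ => 0) step e (g e)); auto.
  apply PF_iter with (g := g); auto with PF.
  - apply PF_if; auto with PF.
  - intros e j Hj. rewrite E. transitivity j; auto. now apply Nat.Div0.div_le_upper_bound; nia.
Qed.

Lemma PF_mod g k : k <> 0 -> PF g -> PF (fun e => g e mod k).
Proof.
  intros Hk Hg. apply PF_ext with (g := fun e => g e - k * (g e / k)).
  - intros e. now apply Nat.Div0.mod_eq.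
  - apply PF_sub; auto. apply PF_mul; auto with PF. now apply PF_div.
Qed.

(** The power [2 ^ h e] may be exponential and must not appear as an intermediate value; repeated
    halving never exceeds [g e]. *)
Lemma PF_shift g h : PF g -> PF h -> PF (fun e => g e / 2 ^ h e).
Proof.
  intros Hg Hh.
  assert (E : forall e j, iter_fun g (fun e => nth 0 e 0 / 2) e j = g e / 2 ^ j).
  { induction j as [|j IH]; cbn [iter_fun]; [now rewrite Nat.div_1_r|].
    cbn [nth]. rewrite IH, Nat.pow_succ_r', (Nat.mul_comm 2). apply Nat.Div0.div_div. }
  apply PF_ext with (g := fun e => iter_fun g (fun e => nth 0 e 0 / 2) e (h e)); auto.
  apply PF_iter with (g := g); auto with PF.
  - apply PF_div; auto with PF.
  - intros e j Hj. rewrite E. apply Nat.Div0.div_le_upper_bound.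
    pose proof (Nat.pow_nonzero 2 j). nia.
Qed.

(** A map that never increases its argument keeps all iterates below [g e], which is the bound that
    [PF_iter] asks for. *)
Lemma PF_iterate (F : nat -> nat) n g :
  (forall z, F z <= z) -> PF (fun e => F (nth 0 e 0)) -> PF n -> PF g ->
  PF (fun e => Nat.iter (n e) F (g e)).
Proof.
  intros HF HPF Hn Hg.
  assert (E : forall e j, iter_fun g (fun e => F (nth 0 e 0)) e j = Nat.iter j F (g e)).
  { induction j as [|j IH]; auto. cbn [iter_fun nth]. now rewrite IH. }
  apply PF_ext with (g := fun e => iter_fun g (fun e => F (nth 0 e 0)) e (n e)).
  - intros e. now rewrite E.
  - apply PF_iter with (g := g); auto with PF.
    intros e j _. rewrite E. induction j as [|j IH]; auto.
    etransitivity; [apply HF|exact IH].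
Qed.

Lemma PF_apply (F : nat -> nat) g : PF (fun e => F (nth 0 e 0)) -> PF g -> PF (fun e => F (g e)).
Proof.
  intros HF Hg. apply (PF_comp (fun e => F (nth 0 e 0)) [g]); auto.
Qed.

(** * Input words as base-4 numbers *)

Definition digit (a : sym) : nat :=
  match a with S0 => 1 | S1 => 2 | Ssep => 3 | Sblank => 0 end.

(** The head is the lowest digit, so division by 4 drops it. Only blanks have digit 0; hence a word
    without blanks is no longer than its code, and a zero remainder marks its end. *)
Fixpoint code (w : list sym) : nat :=
  match w with [] => 0 | a :: w => digit a + 4 * code w end.

Definition nonblank (w : list sym) : Prop := Forall (fun a => a <> Sblank) w.

(* The base-4 digits 1, 2, 3 stand for 0, 1 and the separator. [strip] drops a bit but
   stalls at a separator, so iterating it often enough removes exactly one chunk. *)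
Definition strip (J : nat) : nat := if J mod 4 =? 3 then J else J / 4.

Definition lstrip (w : list sym) : list sym :=
  match w with Ssep :: _ => w | _ => tl w end.

(** [I] passes are enough because a blank-free word is no longer than its code; the last division
    removes the separator at which [strip] stalls. *)
Definition rest (I : nat) : nat := Nat.iter I strip I / 4.

(* Bits are stored least significant first, so they are accumulated from the far end;
   the accumulator stays 0 as long as [strip] is stalled or the input is exhausted. *)
Fixpoint value_upto (I i : nat) : nat :=
  match i with
  | 0 => 0
  | S i => let J := Nat.iter (I - S i) strip I in
           if J mod 4 =? 1 then 2 * value_upto I i
           else if J mod 4 =? 2 then S (2 * value_upto I i) else 0
  end.

Definition value (I : nat) : nat := value_upto I I.

Lemma strip_le J : strip J <= J.
Proof.
  unfold strip. destruct (J mod 4 =? 3); auto. apply Nat.Div0.div_le_upper_bound. lia.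
Qed.

Lemma iter_strip_le n J : Nat.iter n strip J <= J.
Proof. induction n as [|n IH]; simpl; auto. rewrite strip_le. exact IH. Qed.

Lemma rest_le I : rest I <= I.
Proof.
  unfold rest. apply Nat.Div0.div_le_upper_bound. pose proof (iter_strip_le I I). lia.
Qed.

(** Replacing the base-4 digits 1 and 2 by the binary digits 0 and 1 only lowers the number. This
    bounds the iteration in [PF_value] and, through [value_le], the coefficients in
    [decide_spec]. *)
Lemma value_upto_le I i : i <= I -> value_upto I i <= Nat.iter (I - i) strip I.
Proof.
  induction i as [|i IH]; intros Hi; [simpl; lia|]. cbn [value_upto]. cbv zeta.
  set (J := Nat.iter (I - S i) strip I).
  assert (E : Nat.iter (I - i) strip I = strip J).
  { replace (I - i) with (S (I - S i)) by lia. reflexivity. }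
  rewrite E in IH. specialize (IH ltac:(lia)). unfold strip in IH.
  pose proof (Nat.div_mod J 4 ltac:(discriminate)).
  destruct (Nat.eqb_spec (J mod 4) 3), (Nat.eqb_spec (J mod 4) 1), (Nat.eqb_spec (J mod 4) 2); lia.
Qed.

Lemma value_le I : value I <= I.
Proof.
  unfold value. rewrite value_upto_le by auto. apply iter_strip_le.
Qed.

Lemma PF_strip : PF (fun e => strip (nth 0 e 0)).
Proof. apply PF_if; [apply PFb_eqb; [apply PF_mod|]|..]; auto using PF_div with PF. Qed.

Lemma PF_rest g : PF g -> PF (fun e => rest (g e)).
Proof.
  intros Hg. apply PF_div; auto. apply PF_iterate; auto using strip_le, PF_strip.
Qed.

Lemma PF_value g : PF g -> PF (fun e => value (g e)).
Proof.
  intros Hg. apply PF_apply with (F := value); auto.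
  set (J := fun e => Nat.iter (nth 2 e 0 - S (nth 1 e 0)) strip (nth 2 e 0)).
  set (step := fun e => if J e mod 4 =? 1 then 2 * nth 0 e 0
                        else if J e mod 4 =? 2 then S (2 * nth 0 e 0) else 0).
  assert (HJ : PF J) by (apply PF_iterate; auto using strip_le, PF_strip with PF).
  assert (E : forall e i, iter_fun (fun _ => 0) step e i = value_upto (nth 0 e 0) i).
  { induction i as [|i IH]; auto. cbn [iter_fun]. now rewrite IH. }
  apply PF_ext with (g := fun e => iter_fun (fun _ => 0) step e (nth 0 e 0)); [now intros; rewrite E|].
  apply PF_iter with (g := fun e => nth 0 e 0); auto with PF.
  - apply PF_if; [apply PFb_eqb; [apply PF_mod|]|..]; auto with PF.
    apply PF_if; [apply PFb_eqb; [apply PF_mod|]|..]; auto with PF.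
  - intros e j Hj. rewrite E, value_upto_le by auto. apply iter_strip_le.
Qed.

(** * The decision function *)

Definition bit (n z : nat) : bool := (n / 2 ^ z) mod 2 =? 1.

(** [height] at [W = I + 1], over [nat]; the successor makes [1 <= W] immediate. *)
Definition bound (I : nat) : nat :=
  S I * (S I * (S I * (S I + 1)) + S I) + S I.

(* [f] is the remaining input from the map [z -> a z + b] on, where an integer chunk
   has its sign in the lowest bit; [pos - neg] is [a z + b]. *)
Definition closed_at (n I f z : nat) : bool :=
  let a := value f in
  let b := value (rest f) in
  let pos := (if a mod 2 =? 0 then a / 2 * z else 0) + (if b mod 2 =? 0 then b / 2 else 0) in
  let neg := (if a mod 2 =? 0 then 0 else a / 2 * z) + (if b mod 2 =? 0 then 0 else b / 2) in
  negb (bit n z) || (negb (neg <=? pos) || (negb (pos - neg <=? bound I) || bit n (pos - neg))).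

(** The number of maps is not stored in the input but is at most [I], so [j] runs below [I]. Each
    map takes two chunks, and past the last map the remaining input is 0, which [f =? 0] skips; the
    remaining input in front of a map is never 0. *)
Definition separates (n I : nat) : bool :=
  bit n (value I) && (negb (bit n (value (rest I))) &&
  forallb (fun z => forallb (fun j =>
      let f := Nat.iter (2 * j) rest (rest (rest I)) in
      (f =? 0) || closed_at n I f z) (seq 0 I))
    (seq 0 (S (bound I)))).

(* For [X = 2 ^ (bound I + 1)] the numbers below [X] encode the subsets of [0, bound I]. *)
Definition decide (X I : nat) : bool :=
  forallb (fun n => negb (separates n I)) (seq 0 X).

Lemma PFb_bit g h : PF g -> PF h -> PFb (fun e => bit (g e) (h e)).
Proof. intros. apply PFb_eqb; auto with PF. apply PF_mod; auto using PF_shift. Qed.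

Lemma PF_bound g : PF g -> PF (fun e => bound (g e)).
Proof. intros. unfold bound. auto 20 with PF. Qed.

#[local] Hint Resolve PFb_bit PF_bound PF_value PF_rest : PF.
#[local] Hint Extern 2 (PF (fun _ => _ mod 2)) => (apply PF_mod; [discriminate|]) : PF.
#[local] Hint Extern 2 (PF (fun _ => _ / 2)) => (apply PF_div; [discriminate|]) : PF.

Lemma PFb_closed_at n I f z :
  PF n -> PF I -> PF f -> PF z -> PFb (fun e => closed_at (n e) (I e) (f e) (z e)).
Proof.
  intros Hn HI Hf Hz. unfold closed_at. cbv zeta.
  set (pos := fun e => (if value (f e) mod 2 =? 0 then value (f e) / 2 * z e else 0)
                       + (if value (rest (f e)) mod 2 =? 0 then value (rest (f e)) / 2 else 0)).
  set (neg := fun e => (if value (f e) mod 2 =? 0 then 0 else value (f e) / 2 * z e)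
                       + (if value (rest (f e)) mod 2 =? 0 then 0 else value (rest (f e)) / 2)).
  assert (HP : PF pos).
  { apply PF_add; apply PF_if; auto 6 with PF. }
  assert (HN : PF neg).
  { apply PF_add; apply PF_if; auto 6 with PF. }
  change (PFb (fun e => negb (bit (n e) (z e)) || (negb (neg e <=? pos e) ||
     (negb (pos e - neg e <=? bound (I e)) || bit (n e) (pos e - neg e))))).
  repeat apply PFb_orb; auto with PF.
Qed.

Lemma PFb_separates n I : PF n -> PF I -> PFb (fun e => separates (n e) (I e)).
Proof.
  intros Hn HI. unfold separates.
  apply PFb_andb; auto with PF. apply PFb_andb; auto with PF.
  apply PFb_forallb with
    (n := fun e => S (bound (I e)))
    (p := fun e => forallb (fun j => let f := Nat.iter (2 * j) rest (rest (rest (I (tl e)))) in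
            (f =? 0) || closed_at (n (tl e)) (I (tl e)) f (nth 0 e 0)) (seq 0 (I (tl e))));
    auto with PF.
  apply PFb_forallb with
    (n := fun e => I (tl e))
    (p := fun e => let f := Nat.iter (2 * nth 0 e 0) rest (rest (rest (I (tl (tl e))))) in
            (f =? 0) || closed_at (n (tl (tl e))) (I (tl (tl e))) f (nth 1 e 0)); auto with PF.
  assert (HF : PF (fun e => Nat.iter (2 * nth 0 e 0) rest (rest (rest (I (tl (tl e))))))).
  { apply PF_iterate; auto using rest_le with PF. }
  apply PFb_orb; auto with PF. apply PFb_closed_at; auto with PF.
Qed.

Lemma PFb_decide X I : PF X -> PF I -> PFb (fun e => decide (X e) (I e)).
Proof.
  intros HX HI. unfold decide.
  apply PFb_forallb with (n := X) (p := fun e => negb (separates (nth 0 e 0) (I (tl e)))); auto.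
  apply PFb_negb, PFb_separates; auto with PF.
Qed.

(** * Correctness of parsing and of the decision function *)

Lemma bit_spec n z : bit n z = Nat.testbit n z.
Proof.
  unfold bit. pose proof (Nat.testbit_spec' n z) as H.
  destruct (Nat.testbit n z); rewrite <- H; reflexivity.
Qed.

(** Excluded middle chooses each bit. [P] will be reachability within the bound, whose number only
    has to exist among those that [decide] tries. *)
Lemma subset_number (P : nat -> Prop) m :
  exists n, n < 2 ^ m /\ forall z, z < m -> (bit n z = true <-> P z).
Proof.
  induction m as [|m (n & Hn & IH)].
  - exists 0. split; [simpl; lia|]. lia.
  - assert (Hz : forall z, m <= z -> Nat.testbit n z = false).
    { intros z Hz. destruct (Nat.eq_dec n 0) as [->|H0]; [apply Nat.bits_0|].
      apply Nat.bits_above_log2. apply Nat.log2_lt_pow2; [lia|].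
      eapply Nat.lt_le_trans; [exact Hn|]. apply Nat.pow_le_mono_r; lia. }
    destruct (classic (P m)) as [Hm|Hm].
    + exists (n + 2 ^ m). split; [simpl; lia|].
      intros z Hlt. rewrite bit_spec.
      assert (E : n + 2 ^ m = Nat.lor n (2 ^ m)).
      { symmetry. rewrite <- Nat.lxor_lor, Nat.add_nocarry_lxor; auto.
        all: apply Nat.bits_inj; intros i; rewrite Nat.land_spec, Nat.bits_0, Nat.pow2_bits_eqb.
        all: destruct (Nat.eqb_spec m i) as [<-|]; [|apply Bool.andb_false_r].
        all: now rewrite Hz. }
      rewrite E, Nat.lor_spec, Nat.pow2_bits_eqb, <- bit_spec.
      destruct (Nat.eqb_spec m z) as [<-|Hne].
      * rewrite Bool.orb_true_r. tauto.
      * rewrite Bool.orb_false_r. apply IH. lia.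
    + exists n. split; [simpl; lia|].
      intros z Hlt. destruct (Nat.eq_dec z m) as [->|Hne].
      * rewrite bit_spec, Hz by auto. split; [discriminate|tauto].
      * apply IH. lia.
Qed.

Fixpoint bits_value (w : list sym) : nat :=
  match w with
  | S0 :: w => 2 * bits_value w
  | S1 :: w => S (2 * bits_value w)
  | _ => 0
  end.

Definition is_bits (w : list sym) : Prop := Forall (fun a => a = S0 \/ a = S1) w.

Lemma code_div w : code w / 4 = code (tl w).
Proof.
  destruct w as [|a w]; [reflexivity|]. cbn [code tl].
  rewrite Nat.mul_comm, Nat.div_add by discriminate. rewrite Nat.div_small; auto.
  destruct a; simpl; lia.
Qed.

Lemma code_mod w : code w mod 4 = match w with [] => 0 | a :: _ => digit a end.
Proof.
  destruct w as [|a w]; [reflexivity|]. cbn [code].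
  rewrite Nat.mul_comm, Nat.Div0.mod_add. apply Nat.mod_small. destruct a; simpl; lia.
Qed.

Lemma strip_code w : strip (code w) = code (lstrip w).
Proof.
  unfold strip. rewrite code_mod, code_div. destruct w as [|[] w]; reflexivity.
Qed.

Lemma iter_strip_code n w : Nat.iter n strip (code w) = code (Nat.iter n lstrip w).
Proof.
  induction n as [|n IH]; auto. cbn [Nat.iter nat_rect].
  change (strip (Nat.iter n strip (code w)) = code (lstrip (Nat.iter n lstrip w))).
  now rewrite IH, strip_code.
Qed.

Lemma code_length w : nonblank w -> length w <= code w.
Proof. induction 1 as [|[] w Ha _ IH]; simpl; try lia. congruence. Qed.

Lemma iter_lstrip_bits n u w :
  is_bits u -> length u <= n -> (w = [] \/ exists w', w = Ssep :: w') ->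
  Nat.iter n lstrip (u ++ w) = w.
Proof.
  intros Hu. revert n. induction Hu as [|a u Ha _ IH]; intros n Hn Hw.
  - clear Hn. induction n as [|n IH]; auto.
    change (lstrip (Nat.iter n lstrip ([] ++ w)) = w). rewrite IH.
    now destruct Hw as [->|(w' & ->)].
  - destruct n as [|n]; cbn [length] in Hn; [lia|].
    rewrite Nat.iter_succ_r. cbn [app].
    replace (lstrip (a :: u ++ w)) with (u ++ w) by (now destruct Ha as [-> | ->]).
    apply IH; auto. lia.
Qed.

(** After that many strips the word is empty or stalled at a separator, and both have value 0: the
    base case of [value_upto]. *)
Lemma iter_lstrip_stop w n :
  nonblank w -> length w <= n -> bits_value (Nat.iter n lstrip w) = 0.
Proof.
  assert (fixed : forall n v, lstrip v = v -> Nat.iter n lstrip v = v).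
  { intros m v Hv. induction m as [|m IH]; auto.
    change (lstrip (Nat.iter m lstrip v) = v). now rewrite IH. }
  intros Hw. revert n. induction Hw as [|a w Ha Hw IH]; intros n Hn.
  - now rewrite fixed.
  - destruct a; try congruence.
    3: now rewrite fixed.
    all: destruct n as [|n]; cbn [length] in Hn; [lia|]; rewrite Nat.iter_succ_r; apply IH; lia.
Qed.

(** At index [i], [value_upto] has evaluated what remains after [code w - i] strips; induction on
    [i] thus moves from the end of the chunk back to its lowest bit. *)
Lemma value_code w : nonblank w -> value (code w) = bits_value w.
Proof.
  intros Hw. unfold value.
  assert (E : forall i, i <= code w ->
            value_upto (code w) i = bits_value (Nat.iter (code w - i) lstrip w)).
  { induction i as [|i IH]; intros Hi.
    - rewrite iter_lstrip_stop; auto. rewrite Nat.sub_0_r. now apply code_length.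
    - cbn [value_upto]. cbv zeta. rewrite iter_strip_code, code_mod, IH by lia.
      replace (code w - i) with (S (code w - S i)) by lia.
      change (Nat.iter (S (code w - S i)) lstrip w) with (lstrip (Nat.iter (code w - S i) lstrip w)).
      now destruct (Nat.iter (code w - S i) lstrip w) as [|[] v]. }
  rewrite E, Nat.sub_diag by auto. reflexivity.
Qed.

Lemma rest_code u w :
  is_bits u -> nonblank w -> (w = [] \/ exists w', w = Ssep :: w') ->
  rest (code (u ++ w)) = code (tl w).
Proof.
  intros Hu Hn Hw. unfold rest. rewrite iter_strip_code, code_div. do 2 f_equal.
  apply iter_lstrip_bits; auto.
  transitivity (length (u ++ w)); [rewrite length_app; lia|].
  apply code_length, Forall_app. split; auto.
  eapply Forall_impl; [|exact Hu]. intros a [-> | ->]; discriminate.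
Qed.

Lemma bits_nonblank u : is_bits u -> nonblank u.
Proof. apply Forall_impl. intros a [-> | ->]; discriminate. Qed.

Lemma nonblank_app u v : nonblank u -> nonblank v -> nonblank (u ++ v).
Proof. intros. now apply Forall_app. Qed.

Lemma bits_value_app_sep u w :
  is_bits u -> (w = [] \/ exists w', w = Ssep :: w') -> bits_value (u ++ w) = bits_value u.
Proof.
  intros Hu Hw. induction Hu as [|a u Ha _ IH].
  - now destruct Hw as [->|(w' & ->)].
  - destruct Ha as [-> | ->]; simpl; now rewrite IH.
Qed.

Lemma pos_bits_spec p : is_bits (pos_bits p) /\ bits_value (pos_bits p) = Pos.to_nat p.
Proof.
  induction p as [p [I1 I2]|p [I1 I2]|]; cbn [pos_bits bits_value]; split;
    try (constructor; auto); auto; lia.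
Qed.

Lemma N_bits_spec n : is_bits (N_bits n) /\ bits_value (N_bits n) = N.to_nat n.
Proof. destruct n; [split; [constructor|reflexivity]|apply pos_bits_spec]. Qed.

Definition raw_int (z : Z) : nat := 2 * Z.abs_nat z + (if (z <? 0)%Z then 1 else 0).

Lemma enc_int_spec z : is_bits (enc_int z) /\ bits_value (enc_int z) = raw_int z.
Proof.
  destruct (N_bits_spec (Z.abs_N z)) as [H1 H2]. unfold enc_int, raw_int.
  split; [constructor; auto; destruct (z <? 0)%Z; auto|].
  replace (Z.abs_nat z) with (N.to_nat (Z.abs_N z)) by (now destruct z).
  rewrite <- H2. destruct (z <? 0)%Z; cbn [bits_value]; lia.
Qed.

Definition enc_funs (F : list affine) : list sym :=
  flat_map (fun f => [Ssep] ++ enc_int (fst f) ++ [Ssep] ++ enc_int (snd f)) F.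

Lemma enc_funs_cons f F :
  enc_funs (f :: F) = Ssep :: enc_int (fst f) ++ Ssep :: enc_int (snd f) ++ enc_funs F.
Proof. unfold enc_funs. cbn [flat_map app]. now rewrite <- app_assoc. Qed.

Lemma enc_funs_sep F : enc_funs F = [] \/ exists w, enc_funs F = Ssep :: w.
Proof. destruct F; [now left|right; eexists; apply enc_funs_cons]. Qed.

Lemma enc_funs_nonblank F : nonblank (enc_funs F).
Proof.
  induction F as [|f F IH]; [constructor|]. rewrite enc_funs_cons.
  destruct (enc_int_spec (fst f)) as [A _], (enc_int_spec (snd f)) as [B _].
  constructor; [discriminate|]. apply nonblank_app; [now apply bits_nonblank|].
  constructor; [discriminate|]. apply nonblank_app; [now apply bits_nonblank|exact IH].
Qed.

Lemma enc_funs_length F : length F <= length (enc_funs F).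
Proof.
  induction F as [|f F IH]; auto.
  rewrite enc_funs_cons. cbn [length]. rewrite length_app. cbn [length]. rewrite length_app. lia.
Qed.

Lemma enc_input_nonblank x y F : nonblank (enc_input x y F).
Proof.
  destruct (N_bits_spec (N.of_nat x)) as [A _], (N_bits_spec (N.of_nat y)) as [B _].
  apply nonblank_app; [now apply bits_nonblank|].
  apply Forall_cons; [discriminate|].
  apply nonblank_app; [now apply bits_nonblank|apply enc_funs_nonblank].
Qed.

Section Parsing.

Variables (x y : nat) (F : list affine).
Let I := code (enc_input x y F).

Lemma value_x : value I = x.
Proof.
  unfold I. rewrite value_code by apply enc_input_nonblank.
  destruct (N_bits_spec (N.of_nat x)) as [A E]. unfold enc_input.
  rewrite bits_value_app_sep by (auto; right; eexists; reflexivity).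
  unfold enc_nat. rewrite E. apply Nnat.Nat2N.id.
Qed.

Lemma rest_x : rest I = code (enc_nat y ++ enc_funs F).
Proof.
  destruct (N_bits_spec (N.of_nat x)) as [A _].
  pose proof (enc_input_nonblank x y F) as Hn. apply Forall_app in Hn as [_ Hn].
  unfold I, enc_input. rewrite rest_code; auto.
  right. eexists. reflexivity.
Qed.

Lemma value_y : value (rest I) = y.
Proof.
  pose proof (enc_input_nonblank x y F) as Hn.
  apply Forall_app in Hn as [_ Hn]. apply Forall_app in Hn as [_ Hn].
  rewrite rest_x, value_code by exact Hn.
  destruct (N_bits_spec (N.of_nat y)) as [A E].
  rewrite bits_value_app_sep by (auto using enc_funs_sep).
  unfold enc_nat. rewrite E. apply Nnat.Nat2N.id.
Qed.

Lemma rest_y : rest (rest I) = code (tl (enc_funs F)).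
Proof.
  destruct (N_bits_spec (N.of_nat y)) as [A _].
  rewrite rest_x. apply rest_code; auto using enc_funs_sep, enc_funs_nonblank.
Qed.

End Parsing.

(** [rest] also consumes the separator behind a chunk, so the remaining input starts directly with a
    sign symbol; this is the reason for [tl]. *)
Lemma rest_rest_funs f F :
  rest (rest (code (tl (enc_funs (f :: F))))) = code (tl (enc_funs F)) /\
  value (code (tl (enc_funs (f :: F)))) = raw_int (fst f) /\
  value (rest (code (tl (enc_funs (f :: F))))) = raw_int (snd f).
Proof.
  destruct (enc_int_spec (fst f)) as [A Av], (enc_int_spec (snd f)) as [B Bv].
  pose proof (enc_funs_sep F) as Hs. pose proof (enc_funs_nonblank F) as Hn.
  assert (Hn1 : nonblank (enc_int (snd f) ++ enc_funs F)).
  { apply nonblank_app; auto using bits_nonblank. }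
  assert (Hn2 : nonblank (Ssep :: enc_int (snd f) ++ enc_funs F)) by (constructor; [discriminate|auto]).
  rewrite enc_funs_cons. cbn [tl].
  do 2 (rewrite rest_code by eauto; cbn [tl]).
  rewrite !value_code by (auto using nonblank_app, bits_nonblank).
  now rewrite !bits_value_app_sep by eauto.
Qed.

Lemma iter_rest_0 n : Nat.iter n rest 0 = 0.
Proof. induction n as [|n IH]; auto. change (rest (Nat.iter n rest 0) = 0). now rewrite IH. Qed.

Lemma iter_rest_funs F j :
  Nat.iter (2 * j) rest (code (tl (enc_funs F))) = code (tl (enc_funs (skipn j F))).
Proof.
  revert F; induction j as [|j IH]; intros F; [reflexivity|].
  replace (2 * S j) with (S (S (2 * j))) by lia. rewrite !Nat.iter_succ_r.
  destruct F as [|f F].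
  - change (code (tl (enc_funs []))) with 0. change (rest (rest 0)) with 0. apply iter_rest_0.
  - destruct (rest_rest_funs f F) as [E _]. now rewrite E, IH.
Qed.

Lemma raw_int_abs z : (Z.abs z <= Z.of_nat (raw_int z))%Z.
Proof. unfold raw_int. lia. Qed.

(** A signed product as a difference of natural numbers, matching [pos] and [neg] in [closed_at]. It
    is used with [c] the current value for the slope and with [c = 1] for the constant. *)
Lemma raw_int_parts z c :
  (z * Z.of_nat c =
   Z.of_nat (if raw_int z mod 2 =? 0 then raw_int z / 2 * c else 0)%nat -
   Z.of_nat (if raw_int z mod 2 =? 0 then 0 else raw_int z / 2 * c)%nat)%Z.
Proof.
  unfold raw_int. rewrite Nat.mul_comm.
  rewrite (Nat.add_comm (Z.abs_nat z * 2)), Nat.Div0.mod_add, Nat.div_add by discriminate.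
  destruct (Z.ltb_spec z 0); cbn [Nat.modulo Nat.div Nat.divmod fst snd Nat.sub Nat.eqb Nat.add]; nia.
Qed.

Lemma closed_at_spec n I w a b z :
  value w = raw_int a -> value (rest w) = raw_int b ->
  (closed_at n I w z = true <->
   (bit n z = true -> forall v, (Z.of_nat v = app_aff (a, b) (Z.of_nat z))%Z -> v <= bound I ->
    bit n v = true)).
Proof.
  intros Ea Eb. unfold closed_at. cbv zeta. rewrite Ea, Eb.
  pose proof (raw_int_parts a z) as Pa. pose proof (raw_int_parts b 1) as Pb.
  rewrite !Nat.mul_1_r in Pb.
  set (pos := (if raw_int a mod 2 =? 0 then raw_int a / 2 * z else 0)
              + (if raw_int b mod 2 =? 0 then raw_int b / 2 else 0)).
  set (neg := (if raw_int a mod 2 =? 0 then 0 else raw_int a / 2 * z)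
              + (if raw_int b mod 2 =? 0 then 0 else raw_int b / 2)).
  assert (E : app_aff (a, b) (Z.of_nat z) = (Z.of_nat pos - Z.of_nat neg)%Z).
  { unfold app_aff, pos, neg. cbn [fst snd]. rewrite !Nat2Z.inj_add. lia. }
  rewrite E. clearbody pos neg.
  rewrite !Bool.orb_true_iff, !Bool.negb_true_iff, !Nat.leb_gt.
  split.
  - intros H Hz v Hv Hb. replace v with (pos - neg) by lia.
    destruct H as [H|[H|[H|H]]]; auto; try congruence; lia.
  - intros H. destruct (bit n z); [|now left]. right.
    destruct (Nat.lt_ge_cases pos neg); [now left|]. right.
    destruct (Nat.lt_ge_cases (bound I) (pos - neg)); [now left|]. right.
    apply H; auto. lia.
Qed.

Theorem decide_spec x y F :
  let I := code (enc_input x y F) in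
  decide (2 ^ S (bound I)) I = true <-> reach F (Z.of_nat x) (Z.of_nat y).
Proof.
  intros I.
  assert (HlenI : length F <= I).
  { pose proof (code_length _ (enc_input_nonblank x y F)) as H. fold I in H.
    pose proof (enc_funs_length F) as H'. unfold enc_input in H. rewrite !length_app in H.
    fold (enc_funs F) in H. lia. }
  assert (Hfun : forall j f, nth_error F j = Some f ->
    let w := Nat.iter (2 * j) rest (rest (rest I)) in
    w <> 0 /\ value w = raw_int (fst f) /\ value (rest w) = raw_int (snd f)).
  { intros j f Hj w. unfold w, I. rewrite rest_y, iter_rest_funs.
    assert (Es : skipn j F = f :: skipn (S j) F).
    { clear - Hj. revert F Hj; induction j; intros [|g F] Hj; try discriminate; simpl in *.
      - now injection Hj as ->.
      - now apply IHj. }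
    rewrite Es. destruct (rest_rest_funs f (skipn (S j) F)) as (_ & E1 & E2).
    repeat split; auto. intros E0.
    (* The first symbol is the sign of the slope, whose digit is 1 or 2, so the code is positive. *)
    unfold enc_funs in E0. cbn [flat_map app tl enc_int] in E0.
    unfold enc_int in E0. cbn [app code] in E0. destruct (fst f <? 0)%Z; cbn [digit] in E0; lia. }
  assert (Hfun0 : forall j, nth_error F j = None -> Nat.iter (2 * j) rest (rest (rest I)) = 0).
  { intros j Hj%nth_error_None. unfold I. rewrite rest_y, iter_rest_funs, skipn_all2; auto. }
  assert (Hle : forall n, Nat.iter n rest I <= I).
  { induction n as [|n IH]; auto. etransitivity; [apply rest_le|exact IH]. }
  assert (HW : forall f, In f F ->
     (Z.abs (fst f) <= Z.of_nat (S I) /\ Z.abs (snd f) <= Z.of_nat (S I))%Z).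
  { intros f (j & Hj)%In_nth_error. destruct (Hfun j f Hj) as (_ & E1 & E2).
    pose proof (raw_int_abs (fst f)). pose proof (raw_int_abs (snd f)).
    rewrite <- !Nat.iter_succ_r with (f := rest) in E1, E2.
    change (rest (Nat.iter (S (S (2 * j))) rest I)) with (Nat.iter (S (S (S (2 * j)))) rest I) in E2.
    pose proof (value_le (Nat.iter (S (S (2 * j))) rest I)).
    pose proof (value_le (Nat.iter (S (S (S (2 * j)))) rest I)).
    pose proof (Hle (S (S (2 * j)))). pose proof (Hle (S (S (S (2 * j))))).
    rewrite E1 in *. rewrite E2 in *. lia. }
  assert (HB : height (Z.of_nat (S I)) = Z.of_nat (bound I)).
  { unfold height, bound. rewrite !Nat2Z.inj_add, !Nat2Z.inj_mul, !Nat2Z.inj_add, !Nat2Z.inj_mul,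
      !Nat2Z.inj_add. lia. }
  assert (Hx : x <= I) by (rewrite <- (value_x x y F) at 1; apply value_le).
  assert (Hy : y <= I).
  { rewrite <- (value_y x y F) at 1. etransitivity; [apply value_le|]. apply rest_le. }
  rewrite (reach_iff_bounded F (Z.of_nat (S I))) by (auto; lia).
  rewrite HB. unfold decide. rewrite forallb_forall. split.
  - intros Hall. apply NNPP. intros Hno.
    (* If [y] is unreachable, the set of all values reachable from [x] within the bound separates
       [x] from [y]. *)
    destruct (subset_number
      (fun z => path (bounded (Z.of_nat (bound I))) F (Z.of_nat x) (Z.of_nat z)) (S (bound I)))
      as (n & Hn & Hbit).
    specialize (Hall n). rewrite in_seq in Hall. specialize (Hall ltac:(lia)).
    assert (HbI : I <= bound I) by (unfold bound; lia).
    enough (separates n I = true) by (rewrite H in Hall; discriminate).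
    unfold separates, I. rewrite value_x, value_y. fold I.
    rewrite !Bool.andb_true_iff, Bool.negb_true_iff. repeat split.
    + apply Hbit; [lia|]. apply path_refl. unfold bounded. lia.
    + apply Bool.not_true_iff_false. rewrite Hbit by lia. exact Hno.
    + apply forallb_forall. intros z Hz%in_seq. apply forallb_forall. intros j _.
      destruct (nth_error F j) as [f|] eqn:Ej; [|now rewrite Hfun0].
      destruct (Hfun j f Ej) as (_ & E1 & E2). cbv zeta.
      apply Bool.orb_true_iff. right. apply closed_at_spec with (1 := E1) (2 := E2).
      intros Hbz v Hv Hvb. apply Hbit; [lia|]. rewrite Hv.
      rewrite <- surjective_pairing in *. apply path_snoc.
      * apply Hbit; [lia|auto].
      * eapply nth_error_In; eauto.
      * rewrite <- Hv. unfold bounded. lia.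
  - intros Hp n _. apply Bool.negb_true_iff, Bool.not_true_iff_false.
    unfold separates. unfold I. rewrite value_x, value_y. fold I.
    rewrite !Bool.andb_true_iff, Bool.negb_true_iff, forallb_forall. intros (H1 & H2 & Hc).
    (* Membership in a closed set is passed along every bounded path, so a set with [x] would also
       contain [y]. *)
    enough (forall u v, path (bounded (Z.of_nat (bound I))) F u v ->
      bit n (Z.to_nat u) = true -> bit n (Z.to_nat v) = true) as K.
    { apply K in Hp; [|now rewrite Nat2Z.id]. rewrite Nat2Z.id in Hp. congruence. }
    induction 1 as [u Hu | u f v Hu Hf Hpath IH]; auto.
    intros Hbu. apply IH. apply path_start in Hpath. unfold bounded in *.
    specialize (Hc (Z.to_nat u)). rewrite in_seq, forallb_forall in Hc. specialize (Hc ltac:(lia)).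
    apply In_nth_error in Hf as (j & Ej). specialize (Hc j).
    assert (Hj : j < length F) by (apply nth_error_Some; congruence).
    rewrite in_seq in Hc. specialize (Hc ltac:(lia)). cbv zeta in Hc.
    destruct (Hfun j f Ej) as (E0 & E1 & E2).
    apply Bool.orb_true_iff in Hc as [Hc|Hc]; [apply Nat.eqb_eq in Hc; contradiction|].
    apply (proj1 (closed_at_spec n I _ _ _ (Z.to_nat u) E1 E2) Hc Hbu).
    + rewrite <- surjective_pairing, !Z2Nat.id by lia. reflexivity.
    + lia.
Qed.

(** * From register programs to Turing machines *)

(** [ORG] only places the tape marker. It has no rule in [fstep]; [org_run] treats its single
    execution at the start. *)
Inductive instr :=
| ORG
| INC (r : nat)
| DJZ (r l : nat)
| JMP (l : nat)
| RD (l0 l1 l2 : nat).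

Definition target (l0 l1 l2 : nat) (a : sym) : nat :=
  match a with S0 => l0 | S1 => l1 | _ => l2 end.

(* [RD] consumes the last remaining input symbol and branches on it; it falls through
   when no input is left. *)
Inductive fstep (P : list instr) :
  nat -> (nat -> nat) -> list sym -> nat -> (nat -> nat) -> list sym -> Prop :=
| fs_inc pc r s w :
    nth_error P pc = Some (INC r) -> fstep P pc s w (S pc) (upd s r (S (s r))) w
| fs_djz_zero pc r l s w :
    nth_error P pc = Some (DJZ r l) -> s r = 0 -> fstep P pc s w l s w
| fs_djz pc r l s w v :
    nth_error P pc = Some (DJZ r l) -> s r = S v -> fstep P pc s w (S pc) (upd s r v) w
| fs_jmp pc l s w :
    nth_error P pc = Some (JMP l) -> fstep P pc s w l s w
| fs_rd_end pc l0 l1 l2 s :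
    nth_error P pc = Some (RD l0 l1 l2) -> fstep P pc s [] (S pc) s []
| fs_rd pc l0 l1 l2 s w a :
    nth_error P pc = Some (RD l0 l1 l2) ->
    fstep P pc s (w ++ [a]) (target l0 l1 l2 a) s w.

Inductive fsteps (P : list instr) : nat ->
  nat -> (nat -> nat) -> list sym -> nat -> (nat -> nat) -> list sym -> Prop :=
| fsteps_0 pc s w : fsteps P 0 pc s w pc s w
| fsteps_S n pc s w pc1 s1 w1 pc2 s2 w2 :
    fstep P pc s w pc1 s1 w1 -> fsteps P n pc1 s1 w1 pc2 s2 w2 ->
    fsteps P (S n) pc s w pc2 s2 w2.

Lemma fsteps_trans P n m pc s w pc1 s1 w1 pc2 s2 w2 :
  fsteps P n pc s w pc1 s1 w1 -> fsteps P m pc1 s1 w1 pc2 s2 w2 ->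
  fsteps P (n + m) pc s w pc2 s2 w2.
Proof. induction 1; simpl; auto. intros. econstructor; eauto. Qed.

Lemma fsteps_one P pc s w pc1 s1 w1 :
  fstep P pc s w pc1 s1 w1 -> fsteps P 1 pc s w pc1 s1 w1.
Proof. intros. econstructor; eauto. constructor. Qed.

Fixpoint compile (p : cmd) (o : nat) : list instr :=
  match p with
  | Skip => []
  | Inc r => [INC r]
  | Seq p q => compile p o ++ compile q (o + length (compile p o))
  | Loop r p => let c := compile p (S o) in DJZ r (S (S (o + length c))) :: c ++ [JMP o]
  end.

Definition code_at (P : list instr) (o : nat) (c : list instr) : Prop :=
  exists P1 P2, P = P1 ++ c ++ P2 /\ length P1 = o.

Lemma code_at_app P o c c' :
  code_at P o (c ++ c') -> code_at P o c /\ code_at P (o + length c) c'.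
Proof.
  intros (P1 & P2 & -> & <-). split.
  - exists P1, (c' ++ P2). now rewrite <- app_assoc.
  - exists (P1 ++ c), P2. rewrite length_app. split; auto. now rewrite <- !app_assoc.
Qed.

Lemma code_at_cons P o i c :
  code_at P o (i :: c) -> nth_error P o = Some i /\ code_at P (S o) c.
Proof.
  intros H. apply (code_at_app P o [i] c) in H as [(P1 & P2 & -> & <-) H]. split.
  - rewrite nth_error_app2, Nat.sub_diag by auto. reflexivity.
  - now rewrite Nat.add_1_r in H.
Qed.

Lemma compile_correct p s t s' :
  exec p s t s' -> forall P o w, code_at P o (compile p o) ->
  fsteps P t o s w (o + length (compile p o)) s' w.
Proof.
  induction 1 as [s | r s | p q s1 t1 s2 t2 s3 _ IH1 _ IH2 | r p s E
                 | r p s v t1 s1 t2 s2 E _ IH1 _ IH2]; intros P o w Hc; cbn [compile] in *.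
  - cbn [length]. rewrite Nat.add_0_r. constructor.
  - apply code_at_cons in Hc as [Hc _]. cbn [length]. rewrite Nat.add_1_r.
    apply fsteps_one. now constructor.
  - apply code_at_app in Hc as [H1 H2].
    rewrite length_app, Nat.add_assoc. eapply fsteps_trans; eauto.
  - cbv zeta in *. apply code_at_cons in Hc as [Hc _].
    cbn [length]. rewrite length_app. cbn [length].
    replace (o + _) with (S (S (o + length (compile p (S o))))) by lia.
    apply fsteps_one. eapply fs_djz_zero; eauto.
  - pose proof Hc as Hloop. cbv zeta in *. apply code_at_cons in Hc as [Hd Hc].
    apply code_at_app in Hc as [Hp Hj]. apply code_at_cons in Hj as [Hj _].
    eapply fsteps_S; [eapply fs_djz; eauto|].
    eapply fsteps_trans; [apply IH1; exact Hp|].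
    eapply fsteps_S; [eapply fs_jmp; exact Hj|]. now apply IH2.
Qed.

(** Positions inside one instruction. [Lf], [Lg] and [Bk] count down the moves to the next cell of a
    track, since neighbouring cells of a register are [k] apart; [In4 a] remembers the consumed
    symbol; [HomeZ] differs from [Home] in returning to the jump target of [DJZ]. *)
Inductive micro :=
| Entry | Home | HomeZ | In1 | In2 | In3 | In4 (a : sym)
| Lf (j : nat) | Lg (j : nat) | Bk (j : nat).

(* Tape layout: the remaining input occupies the cells 0, 1, ..., cell -1 is blank,
   cell -2 holds [Ssep], and cell -3-u holds [S1] iff register [u mod k] exceeds [u / k].
   Every instruction starts at cell -1. [INC r] and [DJZ r l] walk left along the cells of
   register [r] to the first one that is not [S1]. *)
Definition control (P : list instr) (k : nat) (pc : nat) (m : micro) (a : sym) :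
  option (nat * micro * sym * dir) :=
  match nth_error P pc with
  | None => None
  | Some i =>
    match i, m with
    | ORG, Entry => Some (pc, In1, a, DL)
    | ORG, In1 => Some (pc, In2, a, DL)
    | ORG, In2 => Some (S pc, Entry, Ssep, DR)
    | INC r, Entry | DJZ r _, Entry => Some (pc, Lf (S r), a, DL)
    | INC r, Lf (S j) | DJZ r _, Lf (S j) => Some (pc, Lf j, a, DL)
    | INC r, Lf 0 => match a with
                     | S1 => Some (pc, Lf (k - 1), a, DL)
                     | _ => Some (pc, Home, S1, DR)
                     end
    | DJZ r l, Lf 0 => match a with
                       | S1 => Some (pc, Lg (k - 1), a, DL)
                       | _ => Some (pc, HomeZ, a, DR)
                       end
    | DJZ r l, Lg (S j) => Some (pc, Lg j, a, DL)
    | DJZ r l, Lg 0 => match a with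
                       | S1 => Some (pc, Lg (k - 1), a, DL)
                       | _ => Some (pc, Bk (k - 1), a, DR)
                       end
    | DJZ r l, Bk (S j) => Some (pc, Bk j, a, DR)
    | DJZ r l, Bk 0 => Some (pc, Home, S0, DR)
    | INC _, Home | DJZ _ _, Home => match a with
                 | Ssep => Some (S pc, Entry, a, DR)
                 | _ => Some (pc, Home, a, DR)
                 end
    | DJZ _ l, HomeZ => match a with
                        | Ssep => Some (l, Entry, a, DR)
                        | _ => Some (pc, HomeZ, a, DR)
                        end
    | JMP l, Entry => Some (l, Entry, a, DN)
    | RD _ _ _, Entry => Some (pc, In1, a, DR)
    | RD _ _ _, In1 => match a with
                       | Sblank => Some (S pc, Entry, a, DL)
                       | _ => Some (pc, In2, a, DR)
                       end
    | RD _ _ _, In2 => match a with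
                       | Sblank => Some (pc, In3, a, DL)
                       | _ => Some (pc, In2, a, DR)
                       end
    | RD _ _ _, In3 => Some (pc, In4 a, Sblank, DL)
    | RD l0 l1 l2, In4 b => match a with
                            | Sblank => Some (target l0 l1 l2 b, Entry, a, DN)
                            | _ => Some (pc, In4 b, a, DL)
                            end
    | _, _ => None
    end
  end.

(** * Executing single instructions on the tape *)

Local Open Scope Z_scope.

Definition write (tp : Z -> sym) (h : Z) (b : sym) : Z -> sym :=
  fun x => if x =? h then b else tp x.

Definition offset (d : dir) : Z := match d with DL => -1 | DR => 1 | DN => 0 end.

Section Machine.

Variables (P : list instr) (k : nat).

(** The tape is a function on all integers and the head an absolute position, so that cells have
    fixed addresses; the translation to [config] is postponed to [represents]. *)
Inductive run : nat -> nat * micro * Z * (Z -> sym) -> nat * micro * Z * (Z -> sym) -> Prop :=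
| run_0 c : run 0 c c
| run_S n pc m h tp pc' m' b d c :
    control P k pc m (tp h) = Some (pc', m', b, d) ->
    run n (pc', m', h + offset d, write tp h b) c -> run (S n) (pc, m, h, tp) c.

Lemma run_trans n n' c1 c2 c3 : run n c1 c2 -> run n' c2 c3 -> run (n + n') c1 c3.
Proof. induction 1; simpl; auto. intros. econstructor; eauto. Qed.

Lemma write_same tp h : write tp h (tp h) = tp.
Proof.
  apply functional_extensionality. intros x. unfold write. now destruct (Z.eqb_spec x h) as [->|].
Qed.

Lemma run_read n pc m h tp pc' m' d c :
  control P k pc m (tp h) = Some (pc', m', tp h, d) ->
  run n (pc', m', h + offset d, tp) c -> run (S n) (pc, m, h, tp) c.
Proof. intros H1 H2. econstructor; eauto. now rewrite write_same. Qed.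

Lemma run_walk (mk : nat -> micro) d pc j h tp :
  (forall i a, control P k pc (mk (S i)) a = Some (pc, mk i, a, d)) ->
  run j (pc, mk j, h, tp) (pc, mk 0%nat, h + Z.of_nat j * offset d, tp).
Proof.
  intros H. revert h; induction j as [|j IH]; intros h.
  - simpl. rewrite Z.add_0_r. constructor.
  - eapply run_read; [apply H|].
    replace (h + Z.of_nat (S j) * offset d) with (h + offset d + Z.of_nat j * offset d) by lia.
    apply IH.
Qed.

Lemma run_home m pc pc' u tp :
  (forall a, a <> Ssep -> control P k pc m a = Some (pc, m, a, DR)) ->
  control P k pc m Ssep = Some (pc', Entry, Ssep, DR) ->
  tp (-2) = Ssep -> (forall i : nat, tp (-3 - Z.of_nat i) <> Ssep) ->
  run (S u) (pc, m, -2 - Z.of_nat u, tp) (pc', Entry, -1, tp).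
Proof.
  intros H1 H2 Hs Hn. induction u as [|u IH].
  - eapply run_read; [replace (-2 - Z.of_nat 0) with (-2) by lia; rewrite Hs; exact H2|].
    constructor.
  - eapply run_read.
    + apply H1. replace (-2 - Z.of_nat (S u)) with (-3 - Z.of_nat u) by lia. apply Hn.
    + replace (-2 - Z.of_nat (S u) + offset DR) with (-2 - Z.of_nat u) by (cbn [offset]; lia). exact IH.
Qed.

Lemma run_scan (mk : nat -> micro) pc r v tp :
  (0 < k)%nat ->
  (forall i a, control P k pc (mk (S i)) a = Some (pc, mk i, a, DL)) ->
  control P k pc (mk 0%nat) S1 = Some (pc, mk (k - 1)%nat, S1, DL) ->
  (forall i, (i < v)%nat -> tp (-3 - Z.of_nat (r + k * i)) = S1) ->
  run (k * v) (pc, mk 0%nat, -3 - Z.of_nat r, tp) (pc, mk 0%nat, -3 - Z.of_nat (r + k * v), tp).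
Proof.
  intros Hk Hw H0 Hc. induction v as [|v IH].
  - rewrite Nat.mul_0_r, Nat.add_0_r. constructor.
  - replace (k * S v)%nat with (k * v + S (k - 1))%nat by lia.
    eapply run_trans; [apply IH; intros; apply Hc; lia|].
    eapply run_read; [rewrite Hc by lia; exact H0|].
    replace (-3 - Z.of_nat (r + (k * v + S (k - 1)))) with
      (-3 - Z.of_nat (r + k * v) + offset DL + Z.of_nat (k - 1) * offset DL) by (cbn [offset]; lia).
    now apply run_walk.
Qed.

(** Unmarked register cells may be blank or [S0]. Only [Ssep] is forbidden there, because the walk
    home stops at the first [Ssep] it meets. *)
Definition layout (s : nat -> nat) (w : list sym) (tp : Z -> sym) : Prop :=
  (forall i : nat, tp (Z.of_nat i) = nth i w Sblank) /\
  tp (-1) = Sblank /\ tp (-2) = Ssep /\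
  (forall u : nat, tp (-3 - Z.of_nat u) <> Ssep) /\
  (forall r i : nat, (r < k)%nat -> (tp (-3 - Z.of_nat (r + k * i)) = S1 <-> (i < s r)%nat)).

Lemma cell_inj r i r' i' :
  (r < k)%nat -> (r' < k)%nat -> (r + k * i = r' + k * i')%nat -> r = r' /\ i = i'.
Proof. intros. assert (i = i') by nia. subst. lia. Qed.

Lemma layout_write s w tp r i b v :
  (r < k)%nat -> layout s w tp -> b <> Ssep ->
  (forall j, (b = S1 /\ j = i \/ j <> i /\ (j < s r)%nat) <-> (j < v)%nat) ->
  layout (upd s r v) w (write tp (-3 - Z.of_nat (r + k * i)) b).
Proof.
  intros Hr (H1 & H2 & H3 & H4 & H5) Hb Hv. unfold write. repeat split.
  - intros j. destruct (Z.eqb_spec (Z.of_nat j) (-3 - Z.of_nat (r + k * i))); [lia|auto].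
  - destruct (Z.eqb_spec (-1) (-3 - Z.of_nat (r + k * i))); [lia|auto].
  - destruct (Z.eqb_spec (-2) (-3 - Z.of_nat (r + k * i))); [lia|auto].
  - intros u. destruct (Z.eqb_spec (-3 - Z.of_nat u) (-3 - Z.of_nat (r + k * i))); auto.
  - revert r0 i0 H. intros r' j Hr'. unfold upd.
    destruct (Z.eqb_spec (-3 - Z.of_nat (r' + k * j)) (-3 - Z.of_nat (r + k * i))) as [E|E].
    + destruct (cell_inj r' j r i) as [-> ->]; auto; [lia|].
      rewrite Nat.eqb_refl. rewrite <- Hv. tauto.
    + destruct (Nat.eqb_spec r' r) as [->|].
      * assert (j <> i) by (intros ->; now apply E). rewrite H5 by auto. rewrite <- Hv. tauto.
      * now apply H5.
  - revert r0 i0 H. intros r' j Hr'. unfold upd.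
    destruct (Z.eqb_spec (-3 - Z.of_nat (r' + k * j)) (-3 - Z.of_nat (r + k * i))) as [E|E].
    + destruct (cell_inj r' j r i) as [-> ->]; auto; [lia|].
      rewrite Nat.eqb_refl. rewrite <- Hv. tauto.
    + destruct (Nat.eqb_spec r' r) as [->|].
      * assert (j <> i) by (intros ->; now apply E). rewrite H5 by auto. rewrite <- Hv. tauto.
      * now apply H5.
Qed.

Definition regs_below (i : instr) : Prop :=
  match i with INC r | DJZ r _ => (r < k)%nat | _ => True end.

Lemma run_inc pc r s w tp :
  nth_error P pc = Some (INC r) -> (r < k)%nat -> layout s w tp ->
  exists n tp', (n <= 2 * k * s r + 2 * k + 4)%nat /\
    run n (pc, Entry, -1, tp) (S pc, Entry, -1, tp') /\ layout (upd s r (S (s r))) w tp'.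
Proof.
  intros Hi Hr HL. pose proof HL as (H1 & H2 & H3 & H4 & H5).
  set (u := (r + k * s r)%nat). set (tp' := write tp (-3 - Z.of_nat u) S1).
  assert (HL' : layout (upd s r (S (s r))) w tp').
  { apply layout_write; auto; [discriminate|]. intros j. split; [lia|].
    intros Hj. destruct (Nat.eq_dec j (s r)); [now left|right; lia]. }
  exists (S (S r + (k * s r + S (S u))))%nat, tp'. split; [unfold u; nia|]. split; auto.
  eapply run_read; [unfold control; rewrite Hi; reflexivity|].
  eapply run_trans; [apply (run_walk Lf DL); intros; unfold control; now rewrite Hi|].
  replace (-1 + offset DL + Z.of_nat (S r) * offset DL) with (-3 - Z.of_nat r) by (cbn [offset]; lia).
  eapply run_trans.
  { apply (run_scan Lf pc r (s r)); try (intros; unfold control; now rewrite Hi); [lia|].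
    intros i Hlt. now apply H5. }
  fold u.
  assert (Hu : tp (-3 - Z.of_nat u) <> S1) by (unfold u; rewrite H5 by auto; lia).
  eapply run_S.
  { unfold control. rewrite Hi. destruct (tp (-3 - Z.of_nat u)); try reflexivity. congruence. }
  fold tp'. destruct HL' as (G1 & G2 & G3 & G4 & G5).
  replace (-3 - Z.of_nat u + offset DR) with (-2 - Z.of_nat u) by (cbn [offset]; lia).
  apply run_home; auto; unfold control; rewrite Hi; auto.
  intros a Ha. destruct a; auto. congruence.
Qed.

(** The last marked cell of a track is recognisable only from the unmarked cell after it. So the
    head overshoots by one cell of the track and goes back [k] positions before it erases; the first
    cell alone decides the zero case. *)
Lemma run_djz pc r l s w tp :
  nth_error P pc = Some (DJZ r l) -> (r < k)%nat -> layout s w tp ->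
  exists n tp', (n <= 2 * k * s r + 4 * k + 6)%nat /\
    run n (pc, Entry, -1, tp) ((if s r =? 0 then l else S pc)%nat, Entry, -1, tp') /\
    layout (upd s r (s r - 1)) w tp'.
Proof.
  intros Hi Hr HL. pose proof HL as (H1 & H2 & H3 & H4 & H5).
  assert (Hstart : run (S (S r)) (pc, Entry, -1, tp) (pc, Lf 0, -3 - Z.of_nat r, tp)).
  { eapply run_read; [unfold control; rewrite Hi; reflexivity|].
    replace (-3 - Z.of_nat r) with (-1 + offset DL + Z.of_nat (S r) * offset DL) by (cbn [offset]; lia).
    apply (run_walk Lf DL); intros; unfold control; now rewrite Hi. }
  destruct (s r) as [|v] eqn:Ev; cbn [Nat.eqb].
  - exists (S (S r) + S (S r))%nat, tp. split; [lia|]. split.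
    2:{ replace (upd s r (0 - 1)) with s by ext_upd. auto. }
    eapply run_trans; [exact Hstart|].
    assert (Hu : tp (-3 - Z.of_nat r) <> S1).
    { specialize (H5 r 0%nat Hr). rewrite Nat.mul_0_r, Nat.add_0_r in H5. rewrite H5. lia. }
    eapply run_read.
    { unfold control. rewrite Hi. destruct (tp (-3 - Z.of_nat r)); try reflexivity. congruence. }
    replace (-3 - Z.of_nat r + offset DR) with (-2 - Z.of_nat r) by (cbn [offset]; lia).
    apply run_home; auto; unfold control; rewrite Hi; auto.
    intros a Ha. destruct a; auto. congruence.
  - set (u := (r + k * v)%nat). set (tp' := write tp (-3 - Z.of_nat u) S0).
    assert (HL' : layout (upd s r (S v - 1)) w tp').
    { apply layout_write; auto; [discriminate|]. intros j. split; [intros [[? _]|]; [discriminate|lia]|].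
      intros Hj. right. lia. }
    exists (S (S r) + (S (k - 1) + (k * v + (S (k - 1) + S (S u)))))%nat, tp'.
    split; [unfold u; nia|]. split; auto.
    eapply run_trans; [exact Hstart|].
    eapply run_trans.
    { eapply run_read.
      { assert (E : tp (-3 - Z.of_nat r) = S1).
        { specialize (H5 r 0%nat Hr). rewrite Nat.mul_0_r, Nat.add_0_r in H5. apply H5. lia. }
        rewrite E. unfold control. rewrite Hi. reflexivity. }
      apply (run_walk Lg DL); intros; unfold control; now rewrite Hi. }
    replace (-3 - Z.of_nat r + offset DL + Z.of_nat (k - 1) * offset DL)
      with (-3 - Z.of_nat (r + k)) by (cbn [offset]; lia).
    eapply run_trans.
    { apply (run_scan Lg pc (r + k) v); try (intros; unfold control; now rewrite Hi); [lia|].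
      intros i Hlt. replace (r + k + k * i)%nat with (r + k * S i)%nat by lia.
      apply H5; lia. }
    replace (r + k + k * v)%nat with (r + k * S v)%nat by lia.
    eapply run_trans.
    { eapply run_read.
      { assert (Hu : tp (-3 - Z.of_nat (r + k * S v)) <> S1) by (rewrite H5 by auto; lia).
        unfold control. rewrite Hi.
        destruct (tp (-3 - Z.of_nat (r + k * S v))); try reflexivity. congruence. }
      apply (run_walk Bk DR); intros; unfold control; now rewrite Hi. }
    replace (-3 - Z.of_nat (r + k * S v) + offset DR + Z.of_nat (k - 1) * offset DR)
      with (-3 - Z.of_nat u) by (unfold u; cbn [offset]; lia).
    eapply run_S; [unfold control; rewrite Hi; reflexivity|].
    fold tp'. destruct HL' as (G1 & G2 & G3 & G4 & G5).
    replace (-3 - Z.of_nat u + offset DR) with (-2 - Z.of_nat u) by (cbn [offset]; lia).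
    apply run_home; auto; unfold control; rewrite Hi; auto.
    intros a Ha. destruct a; auto. congruence.
Qed.

Lemma run_rd_end pc l0 l1 l2 s tp :
  nth_error P pc = Some (RD l0 l1 l2) -> layout s [] tp ->
  run 2 (pc, Entry, -1, tp) (S pc, Entry, -1, tp).
Proof.
  intros Hi (H1 & H2 & H3 & H4 & H5).
  eapply run_read; [unfold control; rewrite Hi; reflexivity|].
  eapply run_read.
  - change (-1 + offset DR) with (Z.of_nat 0). rewrite H1. unfold control. now rewrite Hi.
  - constructor.
Qed.

Lemma run_rd pc l0 l1 l2 s w a tp :
  nth_error P pc = Some (RD l0 l1 l2) -> nonblank (w ++ [a]) -> layout s (w ++ [a]) tp ->
  exists tp', run (2 * length w + 5) (pc, Entry, -1, tp) (target l0 l1 l2 a, Entry, -1, tp') /\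
    layout s w tp'.
Proof.
  intros Hi Hn (H1 & H2 & H3 & H4 & H5).
  set (n := length w) in *.
  assert (Hcell : forall i, (i <= n)%nat -> tp (Z.of_nat i) <> Sblank).
  { intros i Hle. rewrite H1. unfold nonblank in Hn. rewrite Forall_forall in Hn. apply Hn, nth_In.
    rewrite length_app. cbn [length]. fold n. lia. }
  assert (Hend : tp (Z.of_nat (S n)) = Sblank).
  { rewrite H1. apply nth_overflow. rewrite length_app. cbn [length]. fold n. lia. }
  assert (Ha : tp (Z.of_nat n) = a) by (rewrite H1; unfold n; apply nth_middle).
  set (tp' := write tp (Z.of_nat n) Sblank).
  exists tp'. split.
  - replace (2 * n + 5)%nat with (2 + (n + (2 + S n)))%nat by lia.
    eapply run_trans.
    { eapply run_read; [unfold control; rewrite Hi; reflexivity|].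
      change (-1 + offset DR) with (Z.of_nat 0). eapply run_read; [|apply run_0].
      specialize (Hcell 0%nat ltac:(lia)).
      unfold control. rewrite Hi. instantiate (1 := DR). instantiate (1 := In2).
      destruct (tp (Z.of_nat 0)); try reflexivity. congruence. }
    assert (Hright : forall m j, (j + m = S n)%nat -> 
              run m (pc, In2, Z.of_nat j, tp) (pc, In2, Z.of_nat (S n), tp)).
    { induction m as [|m IH]; intros j Hj.
      - rewrite Nat.add_0_r in Hj. subst j. constructor.
      - eapply run_read.
        + specialize (Hcell j ltac:(lia)). unfold control. rewrite Hi.
          destruct (tp (Z.of_nat j)); try reflexivity. congruence.
        + replace (Z.of_nat j + offset DR) with (Z.of_nat (S j)) by (cbn [offset]; lia). apply IH. lia. }
    eapply run_trans; [apply (Hright n 1%nat); lia|].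
    eapply run_trans.
    { eapply run_read; [rewrite Hend; unfold control; rewrite Hi; reflexivity|].
      replace (Z.of_nat (S n) + offset DL) with (Z.of_nat n) by (cbn [offset]; lia).
      eapply run_S; [unfold control; rewrite Hi; reflexivity|]. constructor. }
    rewrite Ha. fold tp'.
    assert (Hleft : forall j, (j <= n)%nat ->
              run (S j) (pc, In4 a, Z.of_nat j - 1, tp') (target l0 l1 l2 a, Entry, -1, tp')).
    { induction j as [|j IH]; intros Hj.
      - eapply run_read.
        + change (Z.of_nat 0 - 1) with (-1). replace (tp' (-1)) with Sblank.
          * unfold control. now rewrite Hi.
          * unfold tp', write. destruct (Z.eqb_spec (-1) (Z.of_nat n)); auto.
        + constructor.
      - eapply run_read.
        + replace (Z.of_nat (S j) - 1) with (Z.of_nat j) by lia.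
          replace (tp' (Z.of_nat j)) with (tp (Z.of_nat j)).
          * specialize (Hcell j ltac:(lia)). unfold control. rewrite Hi.
            destruct (tp (Z.of_nat j)); try reflexivity. congruence.
          * unfold tp', write. destruct (Z.eqb_spec (Z.of_nat j) (Z.of_nat n)); auto. lia.
        + replace (Z.of_nat (S j) - 1 + offset DL) with (Z.of_nat j - 1) by (cbn [offset]; lia).
          apply IH. lia. }
    apply Hleft. lia.
  - unfold tp', write. repeat split.
    + intros i. destruct (Z.eqb_spec (Z.of_nat i) (Z.of_nat n)).
      * symmetry. apply nth_overflow. fold n. lia.
      * rewrite H1. destruct (Nat.lt_ge_cases i n) as [Hlt|Hge].
        -- now apply app_nth1.
        -- rewrite !nth_overflow; auto. rewrite length_app. cbn [length]. fold n. lia.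
    + destruct (Z.eqb_spec (-1) (Z.of_nat n)); [lia|auto].
    + destruct (Z.eqb_spec (-2) (Z.of_nat n)); [lia|auto].
    + intros u. destruct (Z.eqb_spec (-3 - Z.of_nat u) (Z.of_nat n)); [lia|auto].
    + destruct (Z.eqb_spec (-3 - Z.of_nat (r + k * i)) (Z.of_nat n)); [lia|]. now apply H5.
    + destruct (Z.eqb_spec (-3 - Z.of_nat (r + k * i)) (Z.of_nat n)); [lia|]. now apply H5.
Qed.

Hypothesis Hregs : Forall regs_below P.

Lemma run_fstep pc s w pc' s' w' tp V :
  fstep P pc s w pc' s' w' -> nonblank w -> layout s w tp -> (forall r, s r <= V)%nat ->
  exists n tp', (n <= 2 * k * V + 4 * k + 2 * length w + 6)%nat /\
    run n (pc, Entry, -1, tp) (pc', Entry, -1, tp') /\ layout s' w' tp' /\ nonblank w'.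
Proof.
  intros Hst Hn HL HV.
  assert (Hr : forall i, nth_error P pc = Some i -> regs_below i).
  { intros i Hi%nth_error_In. rewrite Forall_forall in Hregs. auto. }
  destruct Hst as [pc r s w Hi | pc r l s w Hi E | pc r l s w v Hi E | pc l s w Hi
                  | pc l0 l1 l2 s Hi | pc l0 l1 l2 s w a Hi].
  - destruct (run_inc pc r s w tp Hi (Hr _ Hi) HL) as (n & tp' & L & R & I).
    exists n, tp'. specialize (HV r). split; [nia|auto].
  - destruct (run_djz pc r l s w tp Hi (Hr _ Hi) HL) as (n & tp' & L & R & I).
    rewrite E in *. replace (upd s r (0 - 1)) with s in I by ext_upd.
    exists n, tp'. split; [lia|auto].
  - destruct (run_djz pc r l s w tp Hi (Hr _ Hi) HL) as (n & tp' & L & R & I).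
    specialize (HV r). rewrite E in *. replace (S v - 1)%nat with v in I by lia.
    exists n, tp'. split; [nia|auto].
  - exists 1%nat, tp. split; [lia|]. split; auto.
    eapply run_read; [unfold control; rewrite Hi; reflexivity|]. constructor.
  - exists 2%nat, tp. split; [lia|]. split; auto. eapply run_rd_end; eauto.
  - destruct (run_rd pc l0 l1 l2 s w a tp Hi Hn HL) as (tp' & R & I).
    exists (2 * length w + 5)%nat, tp'. rewrite length_app.
    split; [lia|]. apply Forall_app in Hn as [Hn _]. auto.
Qed.

Lemma fstep_growth pc s w pc' s' w' V :
  fstep P pc s w pc' s' w' -> (forall r, s r <= V)%nat ->
  (forall r, s' r <= S V)%nat /\ (length w' <= length w)%nat.
Proof.
  intros Hst HV. split.
  - intros x. pose proof (HV x).
    destruct Hst; auto; unfold upd; destruct (Nat.eqb_spec x r); subst; lia.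
  - destruct Hst; auto. rewrite length_app. lia.
Qed.

(** Registers grow by at most one per instruction, so they stay below [V + n] throughout. An
    instruction costs a bounded number of sweeps over the tracks or the input, which gives a
    quadratic slowdown. *)
Lemma run_fsteps n pc s w pc' s' w' :
  fsteps P n pc s w pc' s' w' -> forall V tp,
  nonblank w -> layout s w tp -> (forall r, s r <= V)%nat ->
  exists t tp', (t <= n * (2 * k * (V + n) + 4 * k + 2 * length w + 6))%nat /\
    run t (pc, Entry, -1, tp) (pc', Entry, -1, tp').
Proof.
  induction 1 as [|n pc s w pc1 s1 w1 pc2 s2 w2 Hst _ IH]; intros V tp Hn HL HV.
  - exists 0%nat, tp. split; [lia|constructor].
  - destruct (run_fstep _ _ _ _ _ _ tp V Hst Hn HL HV) as (t1 & tp1 & L1 & R1 & HL1 & Hn1).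
    destruct (fstep_growth _ _ _ _ _ _ V Hst HV) as [HV1 Hw1].
    destruct (IH (S V) tp1 Hn1 HL1 HV1) as (t2 & tp2 & L2 & R2).
    exists (t1 + t2)%nat, tp2. split; [|eapply run_trans; eauto].
    assert (E : (2 * k * V <= 2 * k * (V + S n))%nat) by nia.
    replace (S V + n)%nat with (V + S n)%nat in L2 by lia.
    assert (E2 : (n * (2 * k * (V + S n) + 4 * k + 2 * length w1 + 6) <=
                  n * (2 * k * (V + S n) + 4 * k + 2 * length w + 6))%nat).
    { apply Nat.mul_le_mono_l. lia. }
    cbn [Nat.mul]. lia.
Qed.

End Machine.

(** * Numbering the finite control *)

Local Open Scope nat_scope.

Definition enc_micro (m : micro) : nat :=
  match m with
  | Entry => 0 | Home => 1 | HomeZ => 2 | In1 => 3 | In2 => 4 | In3 => 5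
  | In4 S0 => 6 | In4 S1 => 7 | In4 Ssep => 8 | In4 Sblank => 9
  | Lf j => 10 + 3 * j | Lg j => 11 + 3 * j | Bk j => 12 + 3 * j
  end.

Definition dec_micro (n : nat) : micro :=
  match n with
  | 0 => Entry | 1 => Home | 2 => HomeZ | 3 => In1 | 4 => In2 | 5 => In3
  | 6 => In4 S0 | 7 => In4 S1 | 8 => In4 Ssep | 9 => In4 Sblank
  | _ => let j := (n - 10) / 3 in
         match (n - 10) mod 3 with 0 => Lf j | 1 => Lg j | _ => Bk j end
  end.

(** Countdowns start at [S r] with [r < k] or at [k - 1], so [k] bounds them all and the control is
    finite. *)
Definition micro_ok (k : nat) (m : micro) : Prop :=
  match m with Lf j | Lg j | Bk j => j <= k | _ => True end.

Definition width (k : nat) : nat := 13 + 3 * k.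

Lemma dec_micro_big n :
  dec_micro (10 + n) = match n mod 3 with 0 => Lf (n / 3) | 1 => Lg (n / 3) | _ => Bk (n / 3) end.
Proof. unfold dec_micro. now replace (10 + n - 10) with n by lia. Qed.

Lemma dec_enc_micro m : dec_micro (enc_micro m) = m.
Proof.
  assert (H : forall j b, b < 3 -> (b + j * 3) mod 3 = b /\ (b + j * 3) / 3 = j).
  { intros j b Hb. rewrite Nat.Div0.mod_add, Nat.div_add, Nat.mod_small, Nat.div_small; auto. }
  destruct m as [| | | | |  | [] | j | j | j]; try reflexivity; cbn [enc_micro].
  - destruct (H j 0) as [E1 E2]; [lia|]. rewrite dec_micro_big.
    replace (3 * j) with (0 + j * 3) by lia. now rewrite E1, E2.
  - destruct (H j 1) as [E1 E2]; [lia|]. change (11 + 3 * j) with (10 + (1 + 3 * j)).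
    rewrite dec_micro_big. replace (1 + 3 * j) with (1 + j * 3) by lia. now rewrite E1, E2.
  - destruct (H j 2) as [E1 E2]; [lia|]. change (12 + 3 * j) with (10 + (2 + 3 * j)).
    rewrite dec_micro_big. replace (2 + 3 * j) with (2 + j * 3) by lia. now rewrite E1, E2.
Qed.

Lemma enc_micro_lt k m : micro_ok k m -> enc_micro m < width k.
Proof. unfold width. destruct m as [| | | | |  | [] | j | j | j]; cbn; lia. Qed.

Lemma dec_micro_ok k n : n < width k -> micro_ok k (dec_micro n).
Proof.
  unfold width. intros Hn. destruct (Nat.lt_ge_cases n 10) as [Hs|Hb].
  - do 10 (destruct n as [|n]; [exact I|]). lia.
  - replace n with (10 + (n - 10)) by lia. rewrite dec_micro_big.
    assert ((n - 10) / 3 < S k) by (apply Nat.Div0.div_lt_upper_bound; lia).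
    destruct ((n - 10) mod 3) as [|[|]]; cbn [micro_ok]; lia.
Qed.

Definition instr_ok (k L : nat) (i : instr) : Prop :=
  match i with
  | ORG => True
  | INC r => r < k
  | DJZ r l => r < k /\ l < L
  | JMP l => l < L
  | RD l0 l1 l2 => l0 < L /\ l1 < L /\ l2 < L
  end.

Lemma instr_ok_exists P : exists k L, length P < L /\ Forall (instr_ok k L) P.
Proof.
  assert (Mono : forall k L k' L' i, k <= k' -> L <= L' -> instr_ok k L i -> instr_ok k' L' i).
  { intros k L k' L' [] Hk HL; cbn; lia. }
  induction P as [|i P (k & L & HP & IH)].
  - exists 0, 1. split; auto.
  - assert (Hi : exists k' L', instr_ok k' L' i).
    { destruct i as [|r|r l|l|l0 l1 l2]; cbn.
      - now exists 0, 0.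
      - exists (S r), 0. lia.
      - exists (S r), (S l). lia.
      - exists 0, (S l). lia.
      - exists 0, (S (l0 + l1 + l2)). lia. }
    destruct Hi as (k' & L' & Hi).
    exists (k + k'), (S (L + L')). split; [cbn; lia|].
    constructor; [eapply Mono; [| |exact Hi]; lia|].
    eapply Forall_impl; [|exact IH]. intros a. apply Mono; lia.
Qed.

Lemma control_ok P k L pc m a pc' m' b d :
  length P < L -> Forall (instr_ok k L) P -> pc < L -> micro_ok k m ->
  control P k pc m a = Some (pc', m', b, d) -> pc' < L /\ micro_ok k m'.
Proof.
  intros HP Hok Hpc Hm. unfold control.
  destruct (nth_error P pc) as [i|] eqn:Ei; [|discriminate].
  assert (Hi : instr_ok k L i) by (rewrite Forall_forall in Hok; eapply Hok, nth_error_In; eauto).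
  assert (HS : S pc < L) by (pose proof (proj1 (nth_error_Some P pc) ltac:(congruence)); lia).
  destruct i as [|r|r l|l|l0 l1 l2]; cbn [instr_ok] in Hi;
    destruct m as [| | | | |  | c | [|j] | [|j] | [|j]]; try discriminate;
    cbn [micro_ok] in Hm; try destruct a; intros E; injection E as <- <- <- <-;
    cbn [micro_ok]; try destruct c; cbn [target]; lia.
Qed.

(** A state is the program counter and the micro-state in mixed radix, with [Entry] as 0. The
    accepting state has the counter just past the program, where no instruction is left and the
    machine halts. *)
Definition machine (P : list instr) (k L : nat) : TM := {|
  nst := L * width k;
  start := 0;
  acc := length P * width k;
  delta := fun q a =>
    match control P k (q / width k) (dec_micro (q mod width k)) a with
    | None => None
    | Some (pc, m, b, d) => Some (pc * width k + enc_micro m, b, d)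
    end
|}.

Lemma state_lt k L pc m : pc < L -> micro_ok k m -> pc * width k + enc_micro m < L * width k.
Proof. intros Hpc Hm%enc_micro_lt. nia. Qed.

Lemma delta_state P k L pc m a :
  micro_ok k m ->
  delta (machine P k L) (pc * width k + enc_micro m) a =
  match control P k pc m a with
  | None => None
  | Some (pc', m', b, d) => Some (pc' * width k + enc_micro m', b, d)
  end.
Proof.
  intros Hm%enc_micro_lt. cbn [machine delta].
  assert (E1 : (pc * width k + enc_micro m) / width k = pc).
  { rewrite Nat.add_comm, Nat.div_add, Nat.div_small by lia. lia. }
  assert (E2 : (pc * width k + enc_micro m) mod width k = enc_micro m).
  { now rewrite Nat.add_comm, Nat.Div0.mod_add, Nat.mod_small by lia. }
  now rewrite E1, E2, dec_enc_micro.
Qed.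

Lemma wf_machine P k L : length P < L -> Forall (instr_ok k L) P -> wf_TM (machine P k L).
Proof.
  intros HP Hok. unfold wf_TM. cbn [machine nst start acc].
  assert (Hw : 0 < width k) by (unfold width; lia).
  split; [nia|]. split; [nia|].
  intros q a q' b d Hq E. cbn [delta machine] in E.
  destruct (control _ _ _ _ _) as [[[[pc m] b'] d']|] eqn:Ec; [|discriminate].
  injection E as <- <- <-.
  apply (control_ok P k L) in Ec as [H1 H2]; auto.
  - now apply state_lt.
  - apply Nat.Div0.div_lt_upper_bound. lia.
  - apply dec_micro_ok, Nat.mod_upper_bound. lia.
Qed.

(** * From the integer tape to machine configurations *)

Local Open Scope Z_scope.

(** The default [Sblank] of [nth] supplies the blanks beyond both finite lists, so lists that differ
    by trailing blanks represent the same tape. *)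
Definition represents (k : nat) (c : config) (st : nat * micro * Z * (Z -> sym)) : Prop :=
  let '(pc, m, h, tp) := st in
  cst c = (pc * width k + enc_micro m)%nat /\ ccur c = tp h /\
  (forall i : nat, nth i (cleft c) Sblank = tp (h - 1 - Z.of_nat i)) /\
  (forall i : nat, nth i (cright c) Sblank = tp (h + 1 + Z.of_nat i)).

Lemma represents_move k q b d pc m h tp l r :
  q = (pc * width k + enc_micro m)%nat ->
  (forall i : nat, nth i l Sblank = tp (h - 1 - Z.of_nat i)) ->
  (forall i : nat, nth i r Sblank = tp (h + 1 + Z.of_nat i)) ->
  represents k (let '(l', a, r') := move d l b r in
                {| cst := q; cleft := l'; ccur := a; cright := r' |})
    (pc, m, h + offset d, write tp h b).
Proof.
  intros Hq Hl Hr.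
  assert (W : forall x, x <> h -> write tp h b x = tp x).
  { intros x Hx. unfold write. destruct (Z.eqb_spec x h); congruence. }
  assert (W0 : write tp h b h = b) by (unfold write; now rewrite Z.eqb_refl).
  destruct d; cbn [offset].
  - destruct l as [|a l]; cbn [move represents cst cleft ccur cright]; (split; [exact Hq|]); split.
    + specialize (Hl 0%nat). cbn [nth] in Hl. rewrite W by lia. rewrite Hl. f_equal. lia.
    + split.
      * intros i. rewrite W by lia. specialize (Hl (S i)). destruct i; cbn [nth] in *; rewrite Hl; f_equal; lia.
      * intros [|i]; cbn [nth].
        -- rewrite <- W0 at 1. f_equal. lia.
        -- rewrite W by lia. rewrite Hr. f_equal. lia.
    + specialize (Hl 0%nat). cbn [nth] in Hl. rewrite W by lia. rewrite Hl. f_equal. lia.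
    + split.
      * intros i. rewrite W by lia. specialize (Hl (S i)). cbn [nth] in *. rewrite Hl. f_equal. lia.
      * intros [|i]; cbn [nth].
        -- rewrite <- W0 at 1. f_equal. lia.
        -- rewrite W by lia. rewrite Hr. f_equal. lia.
  - destruct r as [|a r]; cbn [move represents cst cleft ccur cright]; (split; [exact Hq|]); split.
    + specialize (Hr 0%nat). cbn [nth] in Hr. rewrite W by lia. rewrite Hr. f_equal. lia.
    + split.
      * intros [|i]; cbn [nth].
        -- rewrite <- W0 at 1. f_equal. lia.
        -- rewrite W by lia. rewrite Hl. f_equal. lia.
      * intros i. rewrite W by lia. specialize (Hr (S i)). destruct i; cbn [nth] in *; rewrite Hr; f_equal; lia.
    + specialize (Hr 0%nat). cbn [nth] in Hr. rewrite W by lia. rewrite Hr. f_equal. lia.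
    + split.
      * intros [|i]; cbn [nth].
        -- rewrite <- W0 at 1. f_equal. lia.
        -- rewrite W by lia. rewrite Hl. f_equal. lia.
      * intros i. rewrite W by lia. specialize (Hr (S i)). cbn [nth] in *. rewrite Hr. f_equal. lia.
  - cbn [move represents cst cleft ccur cright]. rewrite Z.add_0_r. repeat split; auto.
    + intros i. rewrite W by lia. auto.
    + intros i. rewrite W by lia. auto.
Qed.

Lemma iter_step_run P k L n st st' :
  (length P < L)%nat -> Forall (instr_ok k L) P ->
  run P k n st st' -> forall c,
  represents k c st -> (fst (fst (fst st)) < L)%nat -> micro_ok k (snd (fst (fst st))) ->
  exists c', iter_step (machine P k L) n c = Some c' /\ represents k c' st'.
Proof.
  intros HP Hok. induction 1 as [st | n pc m h tp pc' m' b d st' Ec _ IH];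
    intros c Hc Hpc Hm; cbn [fst snd] in *.
  - exists c. auto.
  - destruct Hc as (Hq & Ha & Hl & Hr).
    destruct (control_ok P k L _ _ _ _ _ _ _ HP Hok Hpc Hm Ec) as [Hpc' Hm'].
    pose proof (represents_move k _ b d pc' m' h tp (cleft c) (cright c) eq_refl Hl Hr) as Hrep.
    cbn [iter_step]. unfold step. rewrite Hq, delta_state, Ha, Ec by exact Hm.
    destruct (move d (cleft c) b (cright c)) as [[l' a'] r'].
    apply IH; auto.
Qed.

(** * The complete program: reading the input and giving the verdict *)

Local Open Scope nat_scope.

Definition zeros : nat -> nat := fun _ => 0.

Fixpoint incs (d r : nat) : cmd :=
  match d with 0 => Skip | S d => Seq (Inc r) (incs d r) end.

Definition push (d : nat) : cmd :=
  Seq (Loop 0 (incs 4 1)) (Seq (move_reg 1 0) (incs d 0)).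

Lemma runs_incs d r s : runs (incs d r) s d (upd s r (s r + d)).
Proof.
  revert s; induction d as [|d IH]; intros s; cbn [incs].
  - exists 0. split; auto. replace (upd s r (s r + 0)) with s by ext_upd. constructor.
  - change (S d) with (1 + d). eapply runs_seq; [now apply runs_inc|].
    eapply runs_weaken; [apply IH|lia|ext_upd].
Qed.

Lemma runs_push d I : runs (push d) (upd zeros 0 I) (18 * I + d + 2) (upd zeros 0 (d + 4 * I)).
Proof.
  set (St j := upd (upd zeros 0 (I - j)) 1 (4 * j)).
  eapply runs_weaken.
  - eapply runs_seq.
    + replace (upd zeros 0 I) with (St 0) by (unfold St, zeros; ext_upd).
      apply runs_loop with (n := I) (T := 4).
      * reflexivity.
      * intros j Hj. eapply runs_weaken; [apply runs_incs|auto|].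
        unfold St, zeros. ext_upd.
    + eapply runs_seq; [now apply runs_move|apply runs_incs].
  - unfold St, upd. cbn [Nat.eqb]. lia.
  - unfold St, zeros. ext_upd. all: cbn [Nat.eqb]; lia.
Qed.

Definition block (d o : nat) : list instr := compile (push d) o ++ [JMP 1].

(** The final [DJZ] turns the verdict in register 3 into a halting position: nonzero falls through
    to the accepting address just past the program, zero jumps one address further. *)
Definition program (main : cmd) : list instr :=
  let l := length (block 1 0) in
  let l' := length (block 2 0) in
  let l'' := length (block 3 0) in
  let m := 3 + l + l' + l'' in
  let c := compile main m in
  [ORG; RD 3 (3 + l) (3 + l + l'); JMP m]
    ++ block 1 3 ++ block 2 (3 + l) ++ block 3 (3 + l + l') ++ c ++ [DJZ 3 (S (S (m + length c)))].

(** Allows the addresses of the blocks to be computed from copies compiled at address 0. *)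
Lemma length_compile p o o' : length (compile p o) = length (compile p o').
Proof.
  revert o o'; induction p as [| r | p IHp q IHq | r p IH]; intros o o'; cbn [compile length]; auto.
  - rewrite !length_app. f_equal; auto.
  - rewrite !length_app. cbn [length]. f_equal. f_equal. apply IH.
Qed.

Lemma length_block d o o' : length (block d o) = length (block d o').
Proof. unfold block. rewrite !length_app. f_equal. apply length_compile. Qed.

Section Program.

Variable main : cmd.
Let P := program main.
Let l := length (block 1 0).
Let l' := length (block 2 0).
Let l'' := length (block 3 0).
Let m := 3 + l + l' + l''.
Let c := compile main m.

Lemma program_layout :
  nth_error P 0 = Some ORG /\ nth_error P 1 = Some (RD 3 (3 + l) (3 + l + l')) /\
  nth_error P 2 = Some (JMP m) /\
  code_at P 3 (block 1 3) /\ code_at P (3 + l) (block 2 (3 + l)) /\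
  code_at P (3 + l + l') (block 3 (3 + l + l')) /\ code_at P m c /\
  nth_error P (m + length c) = Some (DJZ 3 (S (length P))) /\ length P = S (m + length c).
Proof.
  assert (H : code_at P 0 P) by (exists [], []; rewrite app_nil_r; auto).
  assert (HL : length P = S (m + length c)).
  { unfold P, program. cbv zeta. fold l l' l'' m c. rewrite !length_app. cbn [length].
    rewrite (length_block 1 3 0), (length_block 2 _ 0), (length_block 3 _ 0). unfold m, l, l', l''. lia. }
  rewrite HL. unfold P at 2, program in H. cbv zeta in H. fold l l' l'' m c in H. fold m in H. fold c in H.
  cbn [app] in H.
  apply code_at_cons in H as [H0 H]. apply code_at_cons in H as [H1 H].
  apply code_at_cons in H as [H2 H]. apply code_at_app in H as [H3 H].
  rewrite (length_block 1 3 0) in H. apply code_at_app in H as [H4 H].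
  rewrite (length_block 2 _ 0) in H. apply code_at_app in H as [H5 H].
  rewrite (length_block 3 _ 0) in H. apply code_at_app in H as [H6 H].
  apply code_at_cons in H as [H7 _]. repeat split; auto.
Qed.

Lemma block_run d o I w :
  code_at P o (block d o) ->
  exists t, t <= 18 * I + d + 3 /\ fsteps P t o (upd zeros 0 I) w 1 (upd zeros 0 (d + 4 * I)) w.
Proof.
  intros H. apply code_at_app in H as [H1 H2]. apply code_at_cons in H2 as [H2 _].
  destruct (runs_push d I) as (t & Ht & He).
  exists (t + 1). split; [lia|].
  eapply fsteps_trans; [eapply compile_correct; eauto|].
  apply fsteps_one. now apply fs_jmp.
Qed.

(** Input is consumed from its right end, so each symbol is put in front of those already read, and
    the front of a word is the low digit of its code: one multiplication by 4 and an addition per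
    symbol. *)
Lemma read_run w v :
  nonblank w ->
  exists t, t <= length w * (18 * code (w ++ v) + 7) + 1 /\
    fsteps P t 1 (upd zeros 0 (code v)) w 2 (upd zeros 0 (code (w ++ v))) [].
Proof.
  destruct program_layout as (_ & H1 & _ & B1 & B2 & B3 & _).
  revert v; induction w as [|a w IH] using rev_ind; intros v Hn.
  - exists 1. split; [lia|]. apply fsteps_one. eapply fs_rd_end; eauto.
  - apply Forall_app in Hn as [Hn Ha]. inversion Ha as [|? ? Hb _]; subst.
    destruct (IH (a :: v) Hn) as (t2 & L2 & R2).
    assert (E : (w ++ [a]) ++ v = w ++ a :: v) by now rewrite <- app_assoc.
    rewrite E.
    assert (Hle : code v <= code (w ++ a :: v)).
    { clear. induction w as [|b w IH]; cbn [app code] in *; lia. }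
    assert (Hblock : exists t, t <= 18 * code v + 6 /\
      fsteps P t (target 3 (3 + l) (3 + l + l') a) (upd zeros 0 (code v)) w
                 1 (upd zeros 0 (code (a :: v))) w).
    { destruct a; [| | |congruence]; cbn [target code digit].
      - destruct (block_run 1 _ (code v) w B1) as (t & L & R). exists t. split; [lia|exact R].
      - destruct (block_run 2 _ (code v) w B2) as (t & L & R). exists t. split; [lia|exact R].
      - destruct (block_run 3 _ (code v) w B3) as (t & L & R). exists t. split; [lia|exact R]. }
    destruct Hblock as (t1 & L1 & R1).
    exists (1 + (t1 + t2)). split.
    + rewrite length_app. cbn [length]. nia.
    + eapply fsteps_trans; [apply fsteps_one; eapply fs_rd; eauto|].
      eapply fsteps_trans; [exact R1|exact R2].
Qed.

Lemma program_run w T s :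
  nonblank w -> runs main (upd zeros 0 (code w)) T s ->
  exists t s', t <= length w * (18 * code w + 7) + T + 3 /\
    fsteps P t 1 zeros w (if s 3 =? 0 then S (length P) else length P) s' [].
Proof.
  intros Hn (tm & Lm & Rm).
  destruct program_layout as (_ & _ & H2 & _ & _ & _ & Hc & Hd & HL).
  destruct (read_run w [] Hn) as (t1 & L1 & R1). rewrite app_nil_r in *.
  replace (upd zeros 0 (code [])) with zeros in R1 by (unfold zeros; ext_upd).
  apply compile_correct with (P := P) (o := m) (w := []) in Rm; [|exact Hc]. fold c in Rm.
  assert (Hend : exists s', fsteps P 1 (m + length c) s []
             (if s 3 =? 0 then S (length P) else length P) s' []).
  { destruct (s 3) as [|v] eqn:Es; cbn [Nat.eqb].
    - exists s. apply fsteps_one. eapply fs_djz_zero; eauto.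
    - exists (upd s 3 v). rewrite HL. apply fsteps_one. eapply fs_djz; eauto. }
  destruct Hend as (s' & Rend).
  exists (t1 + (1 + (tm + 1))), s'. split; [lia|].
  eapply fsteps_trans; [exact R1|].
  eapply fsteps_trans; [apply fsteps_one; eapply fs_jmp; eauto|].
  eapply fsteps_trans; [exact Rm|exact Rend].
Qed.

End Program.

Lemma org_run P k w :
  nth_error P 0 = Some ORG ->
  exists tp, layout k zeros w tp /\
    run P k 3 (0, Entry, 0%Z, fun i => if (i <? 0)%Z then Sblank else nth (Z.to_nat i) w Sblank)
      (1, Entry, (-1)%Z, tp).
Proof.
  intros Hi. set (tp0 := fun i => if (i <? 0)%Z then Sblank else nth (Z.to_nat i) w Sblank).
  exists (write tp0 (-2) Ssep). split.
  - unfold write, tp0, zeros. repeat split.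
    + intros i. destruct (Z.eqb_spec (Z.of_nat i) (-2)); [lia|].
      destruct (Z.ltb_spec (Z.of_nat i) 0); [lia|]. now rewrite Nat2Z.id.
    + intros u. destruct (Z.eqb_spec (-3 - Z.of_nat u) (-2)); [lia|].
      destruct (Z.ltb_spec (-3 - Z.of_nat u) 0); [discriminate|lia].
    + destruct (Z.eqb_spec (-3 - Z.of_nat (r + k * i)) (-2)); [lia|].
      destruct (Z.ltb_spec (-3 - Z.of_nat (r + k * i)) 0); [discriminate|lia].
    + lia.
  - eapply run_read; [unfold control; rewrite Hi; reflexivity|].
    eapply run_read; [unfold control; rewrite Hi; reflexivity|].
    eapply run_S; [unfold control; rewrite Hi; reflexivity|]. apply run_0.
Qed.

(** * Time bounds exponential in the input number *)

Definition ebound (g : nat -> nat) : Prop := exists c, forall I, g I <= 2 ^ ((2 + I) ^ c).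

Lemma ebound_le f g : (forall I, f I <= g I) -> ebound g -> ebound f.
Proof. intros H (c & Hc). exists c. intros I. rewrite H. apply Hc. Qed.

Lemma ebound_pow2 g c : (forall I, g I <= (2 + I) ^ c) -> ebound (fun I => 2 ^ g I).
Proof. intros H. exists c. intros I. now apply Nat.pow_le_mono_r. Qed.

Lemma ebound_const n : ebound (fun _ => n).
Proof.
  apply ebound_le with (fun _ => 2 ^ n).
  - intros _. apply Nat.lt_le_incl, Nat.pow_gt_lin_r. lia.
  - apply ebound_pow2 with n. intros I.
    transitivity (2 ^ n); [apply Nat.lt_le_incl, Nat.pow_gt_lin_r; lia|].
    apply Nat.pow_le_mono_l. lia.
Qed.

Lemma ebound_id : ebound (fun I => I).
Proof.
  apply ebound_le with (fun I => 2 ^ I).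
  - intros I. apply Nat.lt_le_incl, Nat.pow_gt_lin_r. lia.
  - apply ebound_pow2 with 1. intros I. rewrite Nat.pow_1_r. lia.
Qed.

Lemma ebound_mul f g : ebound f -> ebound g -> ebound (fun I => f I * g I).
Proof.
  intros (a & Ha) (b & Hb). exists (S (a + b)). intros I.
  etransitivity; [apply Nat.mul_le_mono; [apply Ha|apply Hb]|].
  rewrite <- Nat.pow_add_r. apply Nat.pow_le_mono_r; [lia|].
  assert ((2 + I) ^ a <= (2 + I) ^ (a + b)) by (apply Nat.pow_le_mono_r; lia).
  assert ((2 + I) ^ b <= (2 + I) ^ (a + b)) by (apply Nat.pow_le_mono_r; lia).
  rewrite Nat.pow_succ_r'. nia.
Qed.

Lemma ebound_add f g : ebound f -> ebound g -> ebound (fun I => f I + g I).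
Proof.
  intros Hf Hg.
  (* Sums are reduced to products by [f + g <= (f + 1) (g + 1)]. *)
  apply ebound_le with (fun I => S (f I) * S (g I)); [intros; nia|].
  assert (HS : forall h, ebound h -> ebound (fun I => S (h I))).
  { intros h (c & Hc). exists (S c). intros I.
    assert (H : S (2 ^ ((2 + I) ^ c)) <= 2 * 2 ^ ((2 + I) ^ c))
      by (pose proof (Nat.pow_nonzero 2 ((2 + I) ^ c)); lia).
    specialize (Hc I). etransitivity; [|apply Nat.pow_le_mono_r with (b := S ((2 + I) ^ c)); [lia|]].
    - rewrite Nat.pow_succ_r'. lia.
    - rewrite Nat.pow_succ_r'. pose proof (Nat.pow_nonzero (2 + I) c). nia. }
  apply ebound_mul; auto.
Qed.

Lemma ebound_pow f k : ebound f -> ebound (fun I => f I ^ k).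
Proof. intros H. induction k; cbn [Nat.pow]; [apply ebound_const|now apply ebound_mul]. Qed.

#[local] Hint Resolve ebound_const ebound_id ebound_mul ebound_add ebound_pow : ebound.

Definition double : cmd := Seq (Loop 2 (incs 2 3)) (move_reg 3 2).

Lemma runs_double s :
  s 3 = 0 -> runs double s (10 * s 2 + 2) (upd s 2 (2 * s 2)).
Proof.
  intros H3. set (St j := upd (upd s 2 (s 2 - j)) 3 (2 * j)).
  eapply runs_weaken.
  - eapply runs_seq; [|now apply runs_move].
    replace s with (St 0) at 1 by (unfold St; ext_upd).
    apply runs_loop with (n := s 2) (T := 2).
    + reflexivity.
    + intros j Hj. eapply runs_weaken; [apply runs_incs|auto|].
      unfold St. ext_upd.
  - unfold St, upd. cbn [Nat.eqb]. lia.
  - unfold St. ext_upd. all: cbn [Nat.eqb]; lia.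
Qed.

(** [2 ^ S (bound I)] is not polynomial in [I], so a loop of doublings builds it in register 2, and
    the polynomial code for [decide] then receives it as an argument. This is why [decide] takes [X]
    separately. *)
Lemma decide_program :
  exists main B, ebound B /\ forall I,
    exists s, runs main (upd zeros 0 I) (B I) s /\
              s 3 = Nat.b2n (decide (2 ^ S (bound I)) I).
Proof.
  destruct (PF_succ _ (PF_bound _ (PF_var 0))) as (cm & a & Hm).
  destruct (PF_poly _ (PF_succ _ (PF_bound _ (PF_var 0)))) as (a' & Ha').
  destruct (PFb_decide _ _ (PF_var 0) (PF_var 1)) as (cd & b & Hd).
  set (m := fun I => S (bound I)).
  exists (Seq (cm [0] 1) (Seq (Inc 2) (Seq (Loop 1 double) (cd [2; 0] 3)))).
  exists (fun I => (2 + I) ^ a + (1 + ((m I * (10 * 2 ^ m I + 2 + 2) + 1) + (2 + (2 ^ m I + I)) ^ b))).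
  split.
  { assert (Hpm : forall I, m I <= (2 + I) ^ a').
    { intros I. specialize (Ha' [I]). unfold size in Ha'. cbn [nth list_sum fold_right] in Ha'.
      now rewrite Nat.add_0_r in Ha'. }
    pose proof (ebound_pow2 m a' Hpm) as H2.
    assert (H1 : ebound m).
    { apply ebound_le with (fun I => 2 ^ m I); auto.
      intros I. apply Nat.lt_le_incl, Nat.pow_gt_lin_r. lia. }
    auto 20 with ebound. }
  intros I. set (St j := upd (upd (upd zeros 0 I) 1 (m I - j)) 2 (2 ^ j)).
  eexists. split.
  - eapply runs_seq.
    { eapply runs_weaken; [apply Hm| |reflexivity].
      - repeat constructor.
      - intros r Hr. unfold zeros, upd. destruct (Nat.eqb_spec r 0); auto. lia.
      - cbn. now rewrite Nat.add_0_r. }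
    eapply runs_seq; [apply runs_inc; reflexivity|].
    eapply runs_seq.
    { match goal with |- runs _ ?s _ _ => replace s with (St 0) end.
      2:{ unfold St. cbn [map nth]. unfold zeros. ext_upd. }
      apply runs_loop with (n := m I) (T := 10 * 2 ^ m I + 2).
      - intros j _. reflexivity.
      - intros j Hj. eapply runs_weaken; [apply runs_double; reflexivity| |].
        + unfold St, upd. cbn [Nat.eqb].
          assert (2 ^ j <= 2 ^ m I) by (apply Nat.pow_le_mono_r; lia). lia.
        + unfold St, zeros. ext_upd. }
    eapply runs_weaken; [apply Hd| |reflexivity].
    + repeat constructor.
    + intros r Hr. unfold St, zeros, upd.
      destruct (Nat.eqb_spec r 2), (Nat.eqb_spec r 1), (Nat.eqb_spec r 0); auto; lia.
    + unfold size, St, upd. cbn [map list_sum fold_right Nat.eqb]. now rewrite Nat.add_0_r.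
  - reflexivity.
Qed.

Lemma code_lt w : code w < 4 ^ length w.
Proof.
  induction w as [|a w IH]; cbn [code length Nat.pow]; [lia|]. destruct a; cbn [digit]; lia.
Qed.

(** Since [code w < 4 ^ n], the base [2 + code w] is at most [2 ^ (2 n + 1)], and the inner exponent
    becomes [c (2 n + 1)]. The constant [2 c + 1] is chosen to serve both as coefficient and as
    exponent. *)
Lemma double_exponential c w :
  2 ^ ((2 + code w) ^ c) <= 2 ^ (2 ^ ((2 * c + 1) * (length w + 1) ^ (2 * c + 1))).
Proof.
  set (n := length w). apply Nat.pow_le_mono_r; [lia|].
  assert (H : 2 + code w <= 2 ^ (2 * n + 1)).
  { rewrite Nat.pow_add_r, Nat.pow_mul_r. change (2 ^ 2) with 4. change (2 ^ 1) with 2.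
    pose proof (code_lt w). fold n in H. lia. }
  etransitivity; [apply Nat.pow_le_mono_l, H|].
  rewrite <- Nat.pow_mul_r. apply Nat.pow_le_mono_r; [lia|].
  assert (n + 1 <= (n + 1) ^ (2 * c + 1)).
  { rewrite <- (Nat.pow_1_r (n + 1)) at 1. apply Nat.pow_le_mono_r; lia. }
  nia.
Qed.

Theorem mainTheorem15 :
  exists M : TM, wf_TM M /\
  exists c : nat,
    forall (x y : nat) (F : list affine),
      exists (t : nat) (cfg : config),
        (t <= 2 ^ (2 ^ (c * (length (enc_input x y F) + 1) ^ c)))%nat /\
        iter_step M t (init M (enc_input x y F)) = Some cfg /\
        step M cfg = None /\
        (cst cfg = acc M <-> reach F (Z.of_nat x) (Z.of_nat y)).
Proof.
  destruct decide_program as (main & B & HB & Hmain).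
  set (P := program main).
  destruct (instr_ok_exists P) as (k & L0 & HL0 & Hok0).
  set (L := S L0).
  assert (HL : length P < L) by (unfold L; lia).
  assert (Hok : Forall (instr_ok k L) P).
  { eapply Forall_impl; [|exact Hok0]. intros i. destruct i; cbn; unfold L; lia. }
  exists (machine P k L). split; [now apply wf_machine|].
  (* [N] bounds the number of instructions, where [length w <= code w] makes the reading phase a
     function of the code alone. [T] adds the three moves of [ORG] to the cost of simulating
     them. *)
  set (N := fun I => I * (18 * I + 7) + B I + 3).
  set (T := fun I => 3 + N I * (2 * k * N I + 4 * k + 2 * I + 6)).
  assert (HT : ebound T) by (unfold T, N; auto 20 with ebound).
  destruct HT as (c & Hc). exists (2 * c + 1). intros x y F.
  set (w := enc_input x y F).
  pose proof (enc_input_nonblank x y F) as Hn. fold w in Hn.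
  destruct (Hmain (code w)) as (s & Hs & Hres).
  destruct (program_run main w _ s Hn Hs) as (n & s' & Ln & Rn). fold P in Rn.
  set (pc := if s 3 =? 0 then S (length P) else length P) in *.
  destruct (org_run P k w (proj1 (program_layout main))) as (tp & Hlay & Rorg).
  assert (Hregs : Forall (regs_below k) P).
  { eapply Forall_impl; [|exact Hok]. intros i. destruct i; cbn; lia. }
  (* All registers start at 0, so [V = 0] and the values stay below [n]. *)
  destruct (run_fsteps P k Hregs n _ _ _ _ _ _ Rn 0 tp Hn Hlay) as (t & tp' & Lt & Rt); [auto|].
  pose proof (run_trans _ _ _ _ _ _ _ Rorg Rt) as R.
  destruct (iter_step_run P k L _ _ _ HL Hok R (init (machine P k L) w)) as (cfg & Hit & Hrep).
  - unfold represents.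
    destruct w as [|a w']; cbn [init cst ccur cleft cright]; repeat split; auto.
    + intros i. destruct (Z.ltb_spec (0 - 1 - Z.of_nat i) 0); [now destruct i|lia].
    + intros i. destruct (Z.ltb_spec (0 + 1 + Z.of_nat i) 0); [lia|].
      now destruct i, (Z.to_nat (0 + 1 + Z.of_nat _)).
    + intros i. destruct (Z.ltb_spec (0 - 1 - Z.of_nat i) 0); [now destruct i|lia].
    + intros i. destruct (Z.ltb_spec (0 + 1 + Z.of_nat i) 0); [lia|].
      replace (Z.to_nat (0 + 1 + Z.of_nat i)) with (S i) by lia. reflexivity.
  - cbn. lia.
  - exact I.
  - exists (3 + t), cfg.
    destruct Hrep as (Hst & _). cbn [enc_micro] in Hst.
    split; [|split; [exact Hit|split]].
    + etransitivity; [|apply double_exponential]. rewrite <- Hc.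
      pose proof (code_length w Hn) as Hlen.
      unfold T. assert (HnN : n <= N (code w)) by (unfold N; nia).
      apply Nat.add_le_mono_l. etransitivity; [exact Lt|].
      apply Nat.mul_le_mono; auto. cbn [Nat.add]. nia.
    + unfold step. rewrite Hst, (delta_state P k L pc Entry) by exact I.
      unfold control. assert (Hnone : nth_error P pc = None).
      { apply nth_error_None. unfold pc. destruct (s 3 =? 0); lia. }
      now rewrite Hnone.
    + rewrite <- (decide_spec x y F). fold w. cbn [acc machine]. rewrite Hst.
      assert (0 < width k) by (unfold width; lia).
      unfold pc. rewrite Hres.
      destruct (decide (2 ^ S (bound (code w))) (code w)); cbn [Nat.b2n Nat.eqb].
      * split; auto.
      * split; [nia|discriminate].
Qed.
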